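(* Let $\mathcal H_{\mathbb R}$ be a real Hilbert space and $X_N(f)$ ($f\in\mathcal H_{\mathbb R}$) a family of Hermitian Gaussian $N\times N$ random matrices. Let $k,l\ge2$, let $f_1,\dots,f_k\in\mathcal H_{\mathbb R}$ and $g_1,\dots,g_l\in\mathcal H_{\mathbb R}$ be unit vectors such that $f_i\perp f_{i+1}$ for $i=1,\dots,k$ (with $f_{k+1}=f_1$) and $g_i\perp g_{i+1}$ for $i=1,\dots,l$ (with $g_{l+1}=g_1$), and let $n(1),\dots,n(k),m(1),\dots,m(l)\ge1$ be integers. Then $$\lim_{N\to\infty}k_2\Big\{\mathrm{Tr}\big[V_{n(1)}(X_N(f_1))\cdots V_{n(k)}(X_N(f_k))\big],\ \mathrm{Tr}\big[V_{m(1)}(X_N(g_1))\cdots V_{m(l)}(X_N(g_l))\big]\Big\}=\big\langle[f_1^{\otimes n(1)}\otimes\cdots\otimes f_k^{\otimes n(k)}],\ [g_l^{\otimes m(l)}\otimes\cdots\otimes g_1^{\otimes m(1)}]\big\rangle_{\mathrm{cyc}}.$$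
   Context: $V_n(x)=U_n(x/2)$, where $U_n$ is the $n$-th Chebyshev polynomial of the second kind. Random matrices: $X_N(f)=(x_{ij}(f))_{i,j=1}^N$ is Hermitian for each $f\in\mathcal H_{\mathbb R}$, and the entries form a centered Gaussian family with $E\{x_{ij}(f)x_{kl}(g)\}=0$ for $i<j$, $k<l$, and $E\{x_{ij}(f)\overline{x_{kl}(g)}\}=\delta_{ik}\delta_{jl}\frac1N\langle f,g\rangle$ for $i\le j$, $k\le l$. $\mathrm{Tr}$ is the un-normalized trace; $k_2\{a,b\}=E\{ab\}-E\{a\}E\{b\}$. Circular tensors: with $\mathcal H$ the complexification of $\mathcal H_{\mathbb R}$, circular tensors $[h_1\otimes\cdots\otimes h_n]$ are multilinear and invariant under cyclic rotation of $h_1,\dots,h_n\in\mathcal H$, and $\langle\cdot,\cdot\rangle_{\mathrm{cyc}}$ is determined by $\langle[h_1\otimes\cdots\otimes h_n],[h'_1\otimes\cdots\otimes h'_m]\rangle_{\mathrm{cyc}}=\delta_{nm}\sum_{k=0}^{n-1}\langle h_1,h'_{1+k}\rangle\cdots\langle h_n,h'_{n+k}\rangle$, indices of $h'$ modulo $n$. Here $f^{\otimes n}$ stands for $n$ consecutive factors $f$. *)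

(* Defs.v *)
From HB Require Import structures.
From mathcomp Require Export all_boot all_order all_algebra sesquilinear complex.
From mathcomp Require Export all_classical all_reals all_analysis.
From mathcomp Require Import ring.

Set Implicit Arguments.
Unset Strict Implicit.
Unset Printing Implicit Defensive.

Import Order.TTheory GRing.Theory Num.Theory numFieldNormedType.Exports.

Local Open Scope classical_set_scope.
Local Open Scope ring_scope.
Local Open Scope complex_scope.

Section Chebyshev.
Variable F : fieldType.

Fixpoint chebU (n : nat) : {poly F} :=
  match n with
  | 0 => 1
  | n1.+1 => match n1 with
             | 0 => 'X *+ 2
             | n2.+1 => ('X *+ 2) * chebU n1 - chebU n2
             end
  end.

Definition chebV (n : nat) : {poly F} := chebU n \Po (2^-1 *: 'X).

End Chebyshev.

Section Complexification.
Variables (R : realType) (H : lmodType R).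

(* The pair (u, v) stands for u + i v. *)
Definition complexification : Type := (H * H)%type.

HB.instance Definition _ := GRing.Zmodule.on complexification.

Definition cplx_scale (z : R[i]) (u : complexification) : complexification :=
  (complex.Re z *: u.1 - complex.Im z *: u.2,
   complex.Re z *: u.2 + complex.Im z *: u.1).

Fact cplx_scaleA a b u :
  cplx_scale a (cplx_scale b u) = cplx_scale (a * b) u.
Proof.
case: a b u => [a1 a2] [b1 b2] [u1 u2]; rewrite /cplx_scale /=; congr pair;
  rewrite !scalerBr !scalerDr !scalerBl !scalerDl !scalerA ?opprD !addrA addrAC;
  by congr (_ + _); rewrite addrAC.
Qed.

Fact cplx_scale1 : left_id 1 cplx_scale.
Proof. by case=> u1 u2; rewrite /cplx_scale /= !scale1r !scale0r subr0 addr0. Qed.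

Fact cplx_scaleDr : right_distributive cplx_scale +%R.
Proof.
move=> [a1 a2] [u1 u2] [v1 v2]; rewrite /cplx_scale /=; congr pair => /=.
- by rewrite !scalerDr opprD addrACA.
- by rewrite !scalerDr addrACA.
Qed.

Fact cplx_scaleDl u : {morph cplx_scale^~ u : a b / a + b}.
Proof.
move: u => [u1 u2] [a1 a2] [b1 b2]; rewrite /cplx_scale /=; congr pair => /=.
- by rewrite !scalerDl opprD addrACA.
- by rewrite !scalerDl addrACA.
Qed.

HB.instance Definition _ := GRing.Zmodule_isLmodule.Build R[i] complexification
  cplx_scaleA cplx_scale1 cplx_scaleDr cplx_scaleDl.

Definition cplx_embed (u : H) : complexification := (u, 0).

(* The sesquilinear extension of ip, linear in the first argument and
   conjugate-linear in the second. *)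
Definition cplx_dot (ip : H -> H -> R) (u v : complexification) : R[i] :=
  (ip u.1 v.1 + ip u.2 v.2) +i* (ip u.2 v.1 - ip u.1 v.2).

End Complexification.

Section CircularTensors.
Variables (R : realType) (H : lmodType R) (ip : {dot H for (@idfun R)}).

Definition cyc_pairing (s t : seq (complexification H)) : R[i] :=
  if size s == size t then
    \sum_(k < size s) \prod_(i < size s)
      cplx_dot ip s`_i t`_((i + k) %% size s)
  else 0.

(* circ [:: h_1; ...; h_n] is the circular tensor [h_1 ⊗ ... ⊗ h_n]. *)
Record circularTensors := CircularTensors {
  circ_space :> lmodType R[i];
  circ : seq (complexification H) -> circ_space;
  circ_linear : forall s t, linear (fun h => circ (s ++ h :: t));
  circ_rot : forall k s, circ (rot k s) = circ s;
  circ_span : forall v : circ_space,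
    exists r : seq (R[i] * seq (complexification H)),
      v = \sum_(p <- r) p.1 *: circ p.2;
  cyc_dot : {hermitian_sym circ_space for (@Num.conj R[i])};
  cyc_dotE : forall s t, cyc_dot (circ s) (circ t) = cyc_pairing s t
}.

End CircularTensors.

(* The structure is inhabited: take for circ_space the span, in the space of
   functions on words, of the functions cyc_pairing s, and let circ s be
   cyc_pairing s itself. *)
Section Existence.
Variables (R : realType) (H : lmodType R) (ip : {dot H for (@idfun R)}).
Local Notation HC := (complexification H).
Local Notation C := R[i].
Local Notation cdot := (cplx_dot ip).
Local Notation pairing := (cyc_pairing ip).

Let cdotPl a (u u' v : HC) : cdot (a *: u + u') v = a * cdot u v + cdot u' v.
Proof.
case: a u u' v => [a1 a2] [u1 u2] [v1 v2] [w1 w2]; rewrite /cplx_dot /=.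
rewrite !linearDl !linearNl !linearZl_LR /=.
move: (ip u1 w1) (ip u2 w2) (ip u2 w1) (ip u1 w2) => x1 x2 x3 x4.
move: (ip v1 w1) (ip v2 w2) (ip v2 w1) (ip v1 w2) => y1 y2 y3 y4.
by apply/eqP; rewrite eq_complex; apply/andP; split; apply/eqP; rewrite /=; ring.
Qed.

Let cdotC (u v : HC) : cdot u v = (cdot v u)^*.
Proof.
case: u v => [u1 u2] [v1 v2]; rewrite /cplx_dot /=.
have ipC x y : ip x y = ip y x by rewrite hermC /= expr0 mul1r.
by rewrite (ipC v1) (ipC v2) (ipC v1) (ipC v2) opprB.
Qed.

Let pairingE n s t : size s = n.+1 -> size t = n.+1 ->
  pairing s t = \sum_(k : 'I_n.+1) \prod_(i : 'I_n.+1) cdot s`_i t`_(i + k)%R.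
Proof. by move=> ss st; rewrite /cyc_pairing ss st eqxx. Qed.

Let pairing0 s t : (size s == size t) = false -> pairing s t = 0.
Proof. by rewrite /cyc_pairing => ->. Qed.

Let pairing_linear s t a (u v : HC) w : pairing (s ++ (a *: u + v) :: t) w =
  a * pairing (s ++ u :: t) w + pairing (s ++ v :: t) w.
Proof.
rewrite /cyc_pairing !size_cat /=; case: eqP => _; last by rewrite mulr0 addr0.
rewrite big_distrr -big_split /=; apply: eq_bigr => k _.
have lt_s : (size s < size s + (size t).+1)%N by rewrite addnS ltnS leq_addr.
have D (E : 'I_(size s + (size t).+1) -> C) : \prod_i E i =
  E (Ordinal lt_s) * \prod_(i | i != Ordinal lt_s) E i by rewrite (bigD1 (Ordinal lt_s)).
have nthE h h' (i : 'I_(size s + (size t).+1)) : i != Ordinal lt_s ->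
  (s ++ h :: t)`_i = (s ++ h' :: t)`_i.
  move=> ne_i; rewrite !nth_cat; case: ltnP => // le_si.
  have: (i - size s != 0)%N.
    by rewrite subn_eq0 -ltnNge ltn_neqAle le_si andbT eq_sym.
  by case: (i - size s)%N.
rewrite !D /= !nth_cat ltnn subnn /= cdotPl mulrDl [RHS]addrC -mulrA [RHS]addrC.
by congr (_ * (_ * _) + _ * _); apply: eq_bigr => i /nthE E; rewrite (E _ u) (E _ v).
Qed.

Let nth_rot_mod (s : seq HC) k i : (k <= size s)%N -> (i < size s)%N ->
  (rot k s)`_i = s`_((i + k) %% size s).
Proof.
move=> le_k lt_i; rewrite /rot nth_cat size_drop.
have Es : (size s = (size s - k) + k)%N by rewrite subnK.
have [lt_ik|le_ik] := ltnP.
  by rewrite nth_drop addnC modn_small // Es ltn_add2r.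
have E : (i + k = (i - (size s - k)) + size s)%N.
  by rewrite {2}Es addnA subnK.
have lt_k : (i - (size s - k) < k)%N by rewrite ltn_subLR // -Es.
by rewrite E modnDr modn_small ?nth_take // (leq_trans lt_k).
Qed.

Let pairing_rot k s w : pairing (rot k s) w = pairing s w.
Proof.
have [le_ks|/rot_oversize-> //] := ltnP k (size s).
have [/eqP eq_sw|ne_sw] := boolP (size s == size w); last first.
  by rewrite !pairing0 ?size_rot ?(negPf ne_sw).
case: s le_ks eq_sw => // h s; set s1 := h :: s => le_ks eq_sw.
have ss : size s1 = (size s).+1 by [].
rewrite (pairingE (n := size s)) ?size_rot -?eq_sw //.
rewrite (pairingE (n := size s)) -?eq_sw //.
pose r : 'I_(size s).+1 := Ordinal le_ks.
have nth_rotE (i : 'I_(size s).+1) : (rot k s1)`_i = s1`_(i + r)%R.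
  by rewrite nth_rot_mod // ltnW.
rewrite [RHS](reindex_inj (addrI (- r))); apply: eq_bigr => j _.
rewrite [RHS](reindex_inj (addIr r)); apply: eq_bigr => i _.
have Eij : (i + r) + (- r + j) = i + j by rewrite addrA addrK.
by rewrite nth_rotE Eij.
Qed.

Let pairingC s t : pairing s t = (pairing t s)^*.
Proof.
have [/eqP eq_st|ne_st] := boolP (size s == size t); last first.
  by rewrite !pairing0 ?rmorph0 1?eq_sym ?(negPf ne_st) // eq_sym (negPf ne_st).
case Ds: (size s) => [|n].
  by rewrite /cyc_pairing -eq_st eqxx Ds !big_ord0 rmorph0.
rewrite !(pairingE (n := n)) -?eq_st // rmorph_sum.
rewrite [RHS](reindex_inj oppr_inj); apply: eq_bigr => k _.
rewrite rmorph_prod [RHS](reindex_inj (addIr k)).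
apply: eq_bigr => i _; have Eik : i + k + - k = i by rewrite addrK.
by rewrite Eik [LHS]cdotC.
Qed.

Local Notation F := (seq HC -> C^o).

Let c (s : seq HC) : F := pairing s.

Let rep (v : F) (r : seq (C * seq HC)) := v = \sum_(p <- r) p.1 *: c p.2.

Let S : {pred F} := fun v => `[< exists r, rep v r >].

Let S_submod : submod_closed S.
Proof.
split; first by apply/asboolP; exists [::]; rewrite /rep big_nil.
move=> a _ _ /asboolP[r ->] /asboolP[r' ->]; apply/asboolP.
exists ([seq (a * p.1, p.2) | p <- r] ++ r'); rewrite /rep big_cat /= big_map.
by congr (_ + _); rewrite scaler_sumr; apply: eq_bigr => p _; rewrite scalerA.
Qed.

HB.instance Definition _ := GRing.isSubmodClosed.Build C F S S_submod.

Let V : Type := {v : F | v \in S}.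
HB.instance Definition _ := SubChoice.on V.
HB.instance Definition _ := [SubChoice_isSubLmodule of V by <:].

Let cS s : c s \in S.
Proof.
by apply/asboolP; exists [:: (1, s)]; rewrite /rep big_seq1 scale1r.
Qed.

Let circ0 s : V := Sub (c s) (cS s).

Let rep_of (v : V) := sval (cid (asboolW (valP v : `[< exists r, rep (val v) r >]))).
Let rep_ofP v : rep (val v) (rep_of v).
Proof. exact: svalP (cid _). Qed.

Let ev (v : F) (r : seq (C * seq HC)) : C := \sum_(p <- r) (p.1)^* * v p.2.

Let evC (v w : F) r q : rep v q -> rep w r -> ev v r = (ev w q)^*.
Proof.
move=> -> ->; rewrite /ev rmorph_sum /=.
under eq_bigr do rewrite fct_sumE big_distrr /=.
under [RHS]eq_bigr do rewrite fct_sumE big_distrr rmorph_sum /=.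
rewrite exchange_big /=; apply: eq_bigr => p _; apply: eq_bigr => p' _.
rewrite !rmorphM /= conjcK.
by rewrite -pairingC -[RHS]mulrCA.
Qed.

Let dot (u v : V) : C := ev (val u) (rep_of v).

Let dotC u v : dot u v = (-1) ^+ false * Num.conj (dot v u).
Proof. by rewrite expr0 mul1r; apply: evC; exact: rep_ofP. Qed.

Let dot_bilinear : bilinear_for
  (GRing.Scale.Law.clone _ _ *%R _) (GRing.Scale.Law.clone _ _ (Num.conj \; *%R) _) dot.
Proof.
have dotl u' a u v : dot (a *: u + v) u' = a * dot u u' + dot v u'.
  rewrite /dot /ev big_distrr -big_split /=; apply: eq_bigr => p _.
  by rewrite mulrDr mulrCA.
split=> [u' a u v|u a v w] /=; first exact: dotl.
rewrite dotC dotl expr0 mul1r rmorphD rmorphM /=.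
by rewrite (dotC u v) (dotC u w) !expr0 !mul1r.
Qed.

HB.instance Definition _ := bilinear_isBilinear.Build C V V C
  (GRing.Scale.Law.clone _ _ *%R _) (GRing.Scale.Law.clone _ _ (Num.conj \; *%R) _)
  dot dot_bilinear.
HB.instance Definition _ := isHermitianSesquilinear.Build C V false Num.conj dot dotC.

Lemma circularTensors_exist : inhabited (circularTensors ip).
Proof.
apply: inhabits; unshelve refine (@CircularTensors _ _ _ V circ0 _ _ _
  (dot : {hermitian_sym V for Num.conj}) _).
- move=> s t a u v; apply: val_inj; apply/funext => w; exact: pairing_linear.
- by move=> k s; apply: val_inj; apply/funext => w; exact: pairing_rot.
- move=> v; exists (rep_of v); apply: val_inj.
  by rewrite [LHS](rep_ofP v) linear_sum.
- move=> s t; change (ev (c s) (rep_of (circ0 t)) = pairing s t).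
  have rt : rep (c t) [:: (1, t)] by rewrite /rep big_seq1 scale1r.
  have rs := rep_ofP (circ0 s).
  rewrite (evC rs (rep_ofP (circ0 t))) -(evC rs rt).
  by rewrite /ev big_seq1 rmorph1 mul1r.
Qed.

End Existence.

Section GaussianMatrices.
Context d (T : measurableType d) (R : realType) (P : probability T R).

Definition cexpectation (Z : T -> R[i]) : R[i] :=
  fine 'E_P[fun w => complex.Re (Z w)] +i* fine 'E_P[fun w => complex.Im (Z w)].

(* No complex conjugation on the second argument. *)
Definition k2 (a b : T -> R[i]) : R[i] :=
  cexpectation (fun w => a w * b w) - cexpectation a * cexpectation b.

(* The degenerate case is separate because normal_prob m 0 is not the Dirac
   mass at m. *)
Definition centered_gaussian (Y : T -> R) : Prop :=
  measurable_fun setT Y /\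
  ({ae P, forall w, Y w = 0} \/
   exists2 s : R, 0 < s & forall A, measurable A ->
     P (Y @^-1` A) = normal_prob 0 s A).

(* The maps z |-> Re (a z) are all the real-linear functionals on the complex
   plane, so this says that the real and imaginary parts of the family are
   jointly centered Gaussian. *)
Definition centered_gaussian_family (I : Type) (Z : I -> T -> R[i]) : Prop :=
  forall s : seq (R[i] * I),
    centered_gaussian (fun w => complex.Re (\sum_(p <- s) p.1 * Z p.2 w)).

Definition hermitian_gaussian_matrices (H : lmodType R)
    (ip : {dot H for (@idfun R)}) (N : nat) (X : H -> T -> 'M[R[i]]_N) : Prop :=
  [/\ forall f w, X f w \is hermsymmx,
      centered_gaussian_family
        (fun p : H * ('I_N * 'I_N) => fun w => X p.1 w p.2.1 p.2.2),
      forall f g (i j k l : 'I_N), (i < j)%N -> (k < l)%N ->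
        cexpectation (fun w => X f w i j * X g w k l) = 0 &
      forall f g (i j k l : 'I_N), (i <= j)%N -> (k <= l)%N ->
        cexpectation (fun w => X f w i j * (X g w k l)^*) =
        (i == k)%:R * (j == l)%:R * (N%:R^-1 * (ip f g)%:C)].

(* Tr [V_{n 1}(X (f 1)) ... V_{n k}(X (f k))], with Tr not normalized;
   horner_mx is only available for nonempty matrices, hence the size N.+1. *)
Definition tr_chebV (H : Type) (N : nat) (X : H -> T -> 'M[R[i]]_N.+1)
    (k : nat) (f : 'I_k -> H) (n : 'I_k -> nat) (w : T) : R[i] :=
  \tr (\prod_(i < k) horner_mx (X (f i) w) (chebV _ (n i))).

End GaussianMatrices.

(* The factors of f_1^{⊗ n 1} ⊗ ... ⊗ f_k^{⊗ n k}. *)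
Definition tensor_word (R : realType) (H : lmodType R) (k : nat)
    (f : 'I_k -> H) (n : 'I_k -> nat) : seq (complexification H) :=
  flatten [seq nseq (n i) (cplx_embed (f i)) | i <- enum 'I_k].

(* Main.v *)
Require Import Defs.
From mathcomp Require Import measurable_realfun ring lra.

Set Implicit Arguments.
Unset Strict Implicit.
Unset Printing Implicit Defensive.

Import Order.TTheory GRing.Theory Num.Theory numFieldNormedType.Exports.

Local Open Scope classical_set_scope.
Local Open Scope ring_scope.
Local Open Scope complex_scope.

(** The proof is a computation with Wick polynomials and Gaussian integration
by parts, organized so that the large-N expansion needs neither pairings nor
genus.

To a word in H attach the Wick polynomial given by W() = 1, W(a) = X(a) and
W(a b t) = X(a) W(b t) - <a,b> W(t). The recursion V_{n+2} = x V_{n+1} - V_n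
gives V_n(X(f)) = W(f^n) for a unit vector f (horner_mx_chebV), and
W(u) W(v) = W(uv) as soon as the last letter of u is orthogonal to the first
letter of v (wick_cat). Hence the products of Chebyshev polynomials of the
theorem are the matrices W(h) and W(g) of the concatenated words
(tr_chebV_wick), and the orthogonality of the last and first vectors says that
the two ends of h, and those of g, are orthogonal.

Differentiating W(h) in the direction of a matrix entry cuts h at one letter:
the derivative is the sum over p of (1/N) <a,h_p> W(h_{<p}) (x) W(h_{>p})
(derives_wick). Integration by parts (stein) then yields the Schwinger-Dyson
equation schwinger_dyson for E[Tr(X(a) W(h)) Tr W(g_1) ... Tr W(g_r)]. Its
terms either cut h, with the factor 1/N and two traces, or cut some g_q, with
the factor 1/N and the single trace of W(h) W(g_{q,>p}) W(g_{q,<p}).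
Passing from X(a) W(h) to W(a h) subtracts exactly the term p = 0, the only
one where the first factor is W() and contributes Tr 1 = N
(trace_moment_cons). For this reason the moments
E[Tr W(h_1) ... Tr W(h_r)] of nonempty words are bounded uniformly in N,
without any centering; this goes by induction on the total length, because a
product of Wick polynomials is a linear combination, with coefficients
independent of N, of Wick polynomials of words no longer than the factors together
(bounded_trace_moment).

Boundedness turns the equation for E[Tr W(a h) Tr W(g)] into a limit. The terms
that cut h are 1/N times bounded moments, except for the cut at the last
letter of h, whose coefficient <a, last h> vanishes; the same argument gives
E[Tr W(a h)] -> 0 (tends_off_diagonal). A term that cuts g at p is <a,g_p>
times (1/N) E Tr(W(h) W(g_{>p} g_{<p})), and
(1/N) E Tr(W(u) W(v)) tends to the product of the inner products of the
letters of u with those of v read backwards (tends_trace2). Summing over the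
cutting points p of g is summing over the cyclic rotations of the reversed
word g (sum_word_dot_rot), which is the circular pairing. *)

(** * Moments of the normal distribution *)

Section NormalMoments.
Variables (R : realType) (s : R).
Hypothesis s_gt0 : 0 < s.
Local Notation mu := (@lebesgue_measure R).
Local Notation p := (@normal_pdf R 0 s).

Let s_neq0 : s != 0. Proof. exact: lt0r_neq0. Qed.

Lemma expr_le_fact_expR (n : nat) (y : R) : 0 <= y -> y ^+ n <= n`!%:R * expR y.
Proof.
case: n => [|n] y0; first by rewrite expr0 mul1r -[leLHS]expR0 ler_expR.
rewrite mulrC -ler_pdivrMr ?ltr0n ?fact_gt0 //.
by apply: le_trans (expR_ge1Dxn n y0); rewrite lerDr.
Qed.

(** The factor expR (c x^2) lost when s is replaced by 2 s absorbs any power of x,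
so that integrability of the moments follows from that of a normal density. *)
Lemma moment_pdf_le (n : nat) : exists C : R, forall x : R,
  `|x ^+ n * p x| <= C * normal_pdf 0 (2 * s) x.
Proof.
have s2 : 2 * s != 0 by rewrite mulf_neq0 // pnatr_eq0.
(* c is the difference of 1 / (2 s^2) and 1 / (2 (2 s)^2) *)
pose c : R := 3 / (8 * s ^+ 2).
have c0 : 0 < c by rewrite divr_gt0 // mulr_gt0 // exprn_gt0.
exists ((1 + n`!%:R / c ^+ n) * (normal_peak s / normal_peak (2 * s))) => x.
have a0 := @normal_peak_gt0 R s s_neq0; have b0 := @normal_peak_gt0 R (2 * s) s2.
rewrite !normal_pdfE // /normal_fun !subr0.
have -> : - x ^+ 2 / (s ^+ 2 *+ 2) = - x ^+ 2 / ((2 * s) ^+ 2 *+ 2) - c * x ^+ 2.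
  by rewrite /c; field.
rewrite expRD expRN; set u := expR (- _ / _); set v := expR _.
have u0 : 0 < u by exact: expR_gt0.
have v0 : 0 < v by exact: expR_gt0.
move: (normal_peak s) (normal_peak (2 * s)) a0 b0 => a b a0 b0.
rewrite normrM [`|a * _|]ger0_norm; last by rewrite !mulr_ge0 ?invr_ge0 // ltW.
have xv : `|x ^+ n| <= (1 + n`!%:R / c ^+ n) * v.
  have x2 : (x ^+ 2) ^+ n <= n`!%:R / c ^+ n * v.
    rewrite mulrAC ler_pdivlMr ?exprn_gt0 // mulrC -exprMn.
    by apply: expr_le_fact_expR; rewrite mulr_ge0 ?sqr_ge0 // ltW.
  have v1 : 1 <= v by rewrite -[leLHS]expR0 ler_expR mulr_ge0 ?sqr_ge0 // ltW.
  rewrite mulrDl mul1r; apply: le_trans (lerD v1 x2).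
  have <- : (`|x| ^+ n) ^+ 2 = (x ^+ 2) ^+ n by rewrite exprAC real_normK ?num_real.
  rewrite normrX; move: (`|x| ^+ n) => y; have := sqr_ge0 (y - 1); have := sqr_ge0 y.
  by rewrite sqrrB expr1n mulr1; lra.
apply: (@le_trans _ _ ((1 + n`!%:R / c ^+ n) * v * (a * (u / v)))).
  by rewrite ler_wpM2r // !mulr_ge0 ?invr_ge0 // ltW.
rewrite le_eqVlt; apply/orP; left; apply/eqP; field.
by rewrite !gt_eqF ?exprn_gt0.
Qed.

Lemma measurable_moment_pdf n : measurable_fun setT (fun x : R => x ^+ n * p x).
Proof.
apply: measurable_funM; first by apply: measurable_funX.
exact: measurable_normal_pdf.
Qed.

Lemma integrable_moment_pdf n :
  mu.-integrable setT (fun x : R => (x ^+ n * p x)%:E).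
Proof.
have [C leC] := moment_pdf_le n.
apply: (@le_integrable _ _ _ mu setT _ _ (fun x => (C * normal_pdf 0 (2 * s) x)%:E)) => //.
- by apply/measurable_EFinP; exact: measurable_moment_pdf.
- move=> x _ /=; rewrite lee_fin (le_trans (leC x)) //.
  exact: ler_norm.
- rewrite (_ : (fun x => _) = (fun x => C%:E * (normal_pdf 0 (2 * s) x)%:E)%E) //.
  by apply: integrableZl => //; exact: integrable_normal_pdf.
Qed.

(** By uniqueness of densities; this is what turns integrals for the normal law
into Lebesgue integrals. *)
Lemma normal_prob_density :
  ae_eq mu setT (Radon_Nikodym_SigmaFinite.f (normal_prob 0 s) mu)
    (fun x => (p x)%:E).
Proof.
have dom := @normal_prob_dominates R 0 s.
apply: integral_ae_eq => //.
- exact: Radon_Nikodym_SigmaFinite.f_integrable.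
- by apply/measurable_EFinP; exact: measurable_normal_pdf.
- by move=> A _ mA; rewrite -Radon_Nikodym_SigmaFinite.f_integral.
Qed.

Lemma ge0_integral_normal_prob (f : R -> \bar R) : measurable_fun setT f ->
  (forall x, (0 <= f x)%E) ->
  (\int[normal_prob 0 s]_x f x = \int[mu]_x (f x * (p x)%:E))%E.
Proof.
move=> mf f0; have dom := @normal_prob_dominates R 0 s.
rewrite -(Radon_Nikodym_SigmaFinite.change_of_variables dom) //.
apply: ae_eq_integral => //.
- apply: emeasurable_funM => //; apply: measurable_int.
  exact: Radon_Nikodym_SigmaFinite.f_integrable.
- apply: emeasurable_funM => //; apply/measurable_EFinP.
  exact: measurable_normal_pdf.
- by apply: ae_eqe_mul2l; exact: normal_prob_density.
Qed.

Lemma integrable_moment_normal n :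
  (normal_prob 0 s).-integrable setT (fun x : R => (x ^+ n)%:E).
Proof.
have mX : measurable_fun setT (fun x : R => (x ^+ n)%:E).
  by apply/measurable_EFinP; exact: measurable_funX.
apply/integrableP; split => //.
rewrite ge0_integral_normal_prob; last 2 first.
- by apply: measurableT_comp.
- by move=> x; exact: abse_ge0.
have /integrableP[_] := integrable_moment_pdf n.
under eq_integral do rewrite EFinM abseM (gee0_abs (x := (p _)%:E)) ?lee_fin ?normal_pdf_ge0 //.
by [].
Qed.

Lemma integral_moment_normal n :
  (\int[normal_prob 0 s]_x (x ^+ n)%:E = \int[mu]_x (x ^+ n * p x)%:E)%E.
Proof.
have mX : measurable_fun setT (fun x : R => (x ^+ n)%:E).
  by apply/measurable_EFinP; exact: measurable_funX.
rewrite integralE [RHS]integralE; congr (_ - _)%E;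
  rewrite ge0_integral_normal_prob //; try exact: measurable_funepos; try exact: measurable_funeneg;
  apply: eq_integral => x _; rewrite ?funeposE ?funenegE EFinM.
- by rewrite maxe_pMl ?mul0e // lee_fin normal_pdf_ge0.
- by rewrite -mulNe maxe_pMl ?mul0e // lee_fin normal_pdf_ge0.
Qed.

Lemma is_derive_normal_pdf (x : R) : is_derive x 1 p (- (x / s ^+ 2) * p x).
Proof.
rewrite normal_pdfE // /normal_fun.
pose q (y : R) : R := - (y - 0) ^+ 2 / (s ^+ 2 *+ 2).
have dq : is_derive x 1 q (- (x / s ^+ 2)).
  apply: is_derive_eq; rewrite /GRing.scale /= subr0 ?expr1 ?addr0.
  by field.
have -> : (fun y => normal_peak s * expR (q y)) = normal_peak s \*o (expR \o q) by [].
apply: is_derive_eq; rewrite /GRing.scale /=; ring.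
Qed.

(** The first function is a primitive of the second, because p' = - (x / s^2) p;
for n = 0 the factor n removes the term with the truncated exponent. *)
Definition stein_antiderivative n (x : R) := - (s ^+ 2 * (x ^+ n * p x)).
Definition stein_integrand n (x : R) :=
  x ^+ n.+1 * p x - s ^+ 2 * (n%:R * (x ^+ n.-1 * p x)).

Lemma is_derive_stein n (x : R) :
  is_derive x 1 (stein_antiderivative n) (stein_integrand n x).
Proof.
have dp := is_derive_normal_pdf x.
have dX : is_derive x 1 (fun y : R => y ^+ n) (n%:R * x ^+ n.-1).
  have -> : (fun y : R => y ^+ n) = (@id R) ^+ n.
    by elim: n => [|m IH]; apply/funext => y; rewrite ?expr0 // !exprS [in RHS]/GRing.mul /= -IH.
  by apply: is_derive_eq; rewrite /GRing.scale /= mulr1.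
rewrite (_ : stein_antiderivative n = - (s ^+ 2 \*: ((fun y : R => y ^+ n) * p))) //.
apply: is_derive_eq; rewrite /stein_integrand /GRing.scale /= [x ^+ n.+1]exprS.
by move: (x ^+ n) (x ^+ n.-1) (p x) => a b c; field.
Qed.

Lemma continuous_stein_integrand n : continuous (stein_integrand n).
Proof.
have cp := @continuous_normal_pdf R 0 s s_neq0.
have cX m : continuous (fun x : R => x ^+ m * p x).
  by move=> x; apply: cvgM; [exact: exprn_continuous|exact: cp].
move=> x; apply: cvgB; first exact: cX.
by apply: cvgMr; apply: cvgMr; exact: cX.
Qed.
Lemma integrable_stein_integrand n :
  mu.-integrable setT (fun x => (stein_integrand n x)%:E).
Proof.
rewrite (_ : (fun x => _) = (fun x => (x ^+ n.+1 * p x)%:E) \-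
  (fun x => ((s ^+ 2 * n%:R)%:E * (x ^+ n.-1 * p x)%:E)))%E; last first.
  by apply/funext => x; rewrite /stein_integrand EFinB mulrA [in LHS]EFinM.
apply: integrableB => //; first exact: integrable_moment_pdf.
by apply: integrableZl => //; exact: integrable_moment_pdf.
Qed.

Lemma stein_antiderivative_le n : exists C : R, forall x : R, x != 0 ->
  `|stein_antiderivative n x| <= C / `|x|.
Proof.
have [C leC] := moment_pdf_le n.+1.
have s2 : 2 * s != 0 by rewrite mulf_neq0 // pnatr_eq0.
exists (s ^+ 2 * (`|C| * normal_peak (2 * s))) => x x0.
rewrite ler_pdivlMr ?normr_gt0 // /stein_antiderivative normrN normrM.
rewrite ger0_norm ?sqr_ge0 // -mulrA ler_wpM2l ?sqr_ge0 // -normrM mulrC mulrA -exprS.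
apply: le_trans (leC x) _; apply: le_trans (ler_norm _) _.
by rewrite normrM ler_wpM2l // ger0_norm ?normal_pdf_ge0 // normal_pdf_ub.
Qed.

(** The integral over [-k-1, k+1] is the increment of the antiderivative, which
decays at infinity; dominated convergence identifies the limit. *)
Lemma integral_stein_integrand n : (\int[mu]_x (stein_integrand n x)%:E = 0)%E.
Proof.
pose I (k : nat) : set R := `[- (k.+1%:R : R), k.+1%:R]%classic.
pose f (k : nat) (x : R) := ((fun x => (stein_integrand n x)%:E) \_ (I k)) x.
have mf : measurable_fun setT (fun x => (stein_integrand n x)%:E).
  exact: measurable_int (integrable_stein_integrand n).
have mI k : measurable (I k) by exact: measurable_itv.
have mfk k : measurable_fun setT (f k).
  by apply/(measurable_restrictT _ (mI k)); exact: measurable_funTS.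
have [] := @dominated_convergence _ _ _ mu setT measurableT f
   (fun x => (stein_integrand n x)%:E) (abse \o (fun x => (stein_integrand n x)%:E)) mfk mf.
- apply: aeW => x _; apply: cvg_near_cst.
  near=> k; rewrite /f patchE mem_set // /I /= in_itv /= -ler_norml.
  apply: ltW; apply: lt_le_trans (_ : k%:R <= _); last by rewrite ler_nat.
  by near: k; exact: nbhs_infty_gtr.
- exact: integrable_abse (integrable_stein_integrand n).
- apply: aeW => x k _; rewrite /f patchE; case: ifP => // _.
  by rewrite abse0 abse_ge0.
move=> _ _ /cvg_lim <- //.
have fE k : (\int[mu]_x f k x = (stein_antiderivative n k.+1%:R - stein_antiderivative n (- k.+1%:R))%:E)%E.
  rewrite /f -integral_mkcond EFinB; apply: continuous_FTC2.
  - by rewrite gtrN ?ltr0n.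
  - exact/continuous_subspaceT/continuous_stein_integrand.
  - have dF x : derivable (stein_antiderivative n) x 1 by have [] := is_derive_stein n x.
    have cF x : {for x, continuous (stein_antiderivative n)}.
      exact/differentiable_continuous/derivable1_diffP.
    by split => [x _ //| |]; [apply: cvg_at_right_filter|apply: cvg_at_left_filter]; exact: cF.
  - move=> x _; rewrite derive1E; exact: (@derive_val _ _ _ _ _ _ _ (is_derive_stein n x)).
under eq_fun do rewrite fE.
have [C leC] := stein_antiderivative_le n.
have F0 (g : nat -> R) : (forall k, `|g k| = k.+1%:R) -> (stein_antiderivative n (g k)) @[k --> \oo] --> 0.
  move=> gE; apply/cvgr0Pnorm_le => e e0; near=> k.
  have gk0 : g k != 0 by rewrite -normr_gt0 gE ltr0n.
  apply: le_trans (leC _ gk0) _; rewrite gE ler_pdivrMr ?ltr0n //.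
  rewrite mulrC -ler_pdivrMr //; apply: ltW.
  apply: lt_le_trans (_ : k%:R <= _); last by rewrite ler_nat.
  by near: k; exact: nbhs_infty_gtr.
apply/cvg_lim => //; apply: cvg_EFin; first by apply: nearW.
rewrite -[0](subr0 0); apply: cvgB; apply: F0 => k; rewrite ?normrN ger0_norm //.
Unshelve. all: by end_near. Qed.

Lemma normal_moment_rec n :
  (\int[normal_prob 0 s]_x (x ^+ n.+1)%:E =
   (s ^+ 2 * n%:R)%:E * \int[normal_prob 0 s]_x (x ^+ n.-1)%:E)%E.
Proof.
have i1 := integrable_moment_pdf n.+1; have i2 := integrable_moment_pdf n.-1.
have := integral_stein_integrand n; rewrite !integral_moment_normal.
rewrite (_ : (fun x => _) = (fun x => (x ^+ n.+1 * p x)%:E) \-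
  (fun x => ((s ^+ 2 * n%:R)%:E * (x ^+ n.-1 * p x)%:E)))%E; last first.
  by apply/funext => x; rewrite /stein_integrand EFinB mulrA [in LHS]EFinM.
rewrite integralB //; last exact: integrableZl.
rewrite integralZl // => /eqP; rewrite sube_eq ?add0e => [/eqP //||].
  exact: integrable_fin_num.
by rewrite fin_num_adde_defl // fin_numM // integrable_fin_num.
Qed.

End NormalMoments.

Section GaussianMoments.
Context d (T : measurableType d) (R : realType) (P : probability T R).

(** The recursion for the normal law with s^2 eliminated, so that it also covers
the degenerate law. *)
Lemma gaussian_moments (Y : T -> R) : centered_gaussian P Y ->
  (forall n, P.-integrable setT (fun w => (Y w ^+ n)%:E)) /\
  (forall n, fine 'E_P[fun w => Y w ^+ n.+1] =
    n%:R * fine 'E_P[fun w => Y w ^+ 2] * fine 'E_P[fun w => Y w ^+ n.-1]).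
Proof.
case=> mY [Y0|[s s0 YE]].
  have E0 n : (\int[P]_w (Y w ^+ n.+1)%:E = 0)%E.
    rewrite (@ae_eq_integral _ _ _ P setT (cst 0%E)) ?integral_cst ?mul0e //.
      by apply/measurable_EFinP; exact: measurable_funX.
    by apply: filterS Y0 => w /= -> _; rewrite expr0n.
  split=> n; last by rewrite !unlock !E0 mulr0 mul0r.
  case: n => [|n].
    by under [X in integrable _ _ X]funext => w do rewrite expr0; exact: finite_measure_integrable_cst.
  have mYn : measurable_fun setT (fun w => (Y w ^+ n.+1)%:E).
    by apply/measurable_EFinP; exact: measurable_funX.
  apply/integrableP; split => //.
  rewrite (@ae_eq_integral _ _ _ P setT (cst 0%E)) ?integral_cst ?mul0e //.
    exact: measurableT_comp.
  by apply: filterS Y0 => w /= -> _; rewrite expr0n /= normr0.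
(* the normal law lives on the Lebesgue measurable structure of R, whose display
   differs from that of the Borel structure in the type of Y *)
pose Y' : T -> measurableTypeR R := Y.
have mY' : measurable_fun setT Y' by exact: mY.
have iE (f : measurableTypeR R -> \bar R) : measurable_fun setT f ->
    (forall x, (0 <= f x)%E) ->
    (\int[P]_w f (Y w) = \int[normal_prob 0 s]_x f x)%E.
  move=> mf f0.
  rewrite -(ge0_integral_pushforward mY' P measurableT mf); last by move=> x _; exact: f0.
  by apply: eq_measure_integral => A mA _; rewrite /= -YE.
have mX n : measurable_fun setT (fun x : measurableTypeR R => (x ^+ n)%:E).
  by apply/measurable_EFinP; exact: measurable_funX.
have iY n : P.-integrable setT (fun w => (Y w ^+ n)%:E).
  have /integrableP[_ fi] := integrable_moment_normal s0 n.
  apply/integrableP; split; first by apply: (measurableT_comp (mX n) mY').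
  by rewrite (iE (fun x : measurableTypeR R => `|(x ^+ n)%:E|)%E) //; exact: measurableT_comp.
have EY n : (\int[P]_w (Y w ^+ n)%:E = \int[normal_prob 0 s]_x (x ^+ n)%:E)%E.
  rewrite -(integral_pushforward mY' (mX n) (iY n) measurableT).
  by apply: eq_measure_integral => A mA _; rewrite /= -YE.
split=> // n; rewrite !unlock !EY (normal_moment_rec s0 n) (normal_moment_rec s0 1) /=.
rewrite !fineM //; last 2 first.
- by rewrite -EY; exact: integrable_fin_num.
- by rewrite -EY; exact: integrable_fin_num.
have <- := EY 0; under [X in _ = _ * (_ * fine X) * _]eq_integral do rewrite expr0.
have P1 : fine (1 * P setT)%E = 1 by rewrite mul1e; exact: (congr1 fine (probability_setT P)).
by rewrite integral_cst // P1 /= !mulr1 [_ * n%:R]mulrC.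
Qed.
End GaussianMoments.

(** * Random variables with moments of all orders *)

Section AllMoments.
Context d (T : measurableType d) (R : realType) (P : probability T R).

Definition has_moments (f : T -> R) : Prop :=
  measurable_fun setT f /\
  forall n, P.-integrable setT (fun w => (f w ^+ n)%:E).

Lemma has_moments_integrable f : has_moments f ->
  P.-integrable setT (EFin \o f).
Proof. by case=> _ /(_ 1%N). Qed.

Lemma has_moments_cst (c : R) : has_moments (fun=> c).
Proof. by split=> // n; exact: finite_measure_integrable_cst. Qed.

Lemma has_momentsD f g : has_moments f -> has_moments g ->
  has_moments (fun w => f w + g w).
Proof.
move=> [mf fi] [mg gi]; have mfg : measurable_fun setT (fun w => f w + g w).
  exact: measurable_funD.
split=> // n.
apply: (@le_integrable _ _ _ P setT _ _ (fun w => (2 ^+ n)%:E *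
   (`|(f w ^+ n)%:E| + `|(g w ^+ n)%:E|))%E) => //.
- by apply/measurable_EFinP; exact: measurable_funX.
- move=> w _; rewrite /= lee_fin [leRHS]ger0_norm ?mulr_ge0 ?addr_ge0 ?exprn_ge0 //.
  rewrite !normrX; have key x y : `|x| <= `|y| ->
      `|x + y| ^+ n <= 2 ^+ n * (`|x| ^+ n + `|y| ^+ n :> R).
    move=> le_xy; apply: (@le_trans _ _ ((2 * `|y|) ^+ n)).
      rewrite lerXn2r ?nnegrE ?mulr_ge0 //; apply: le_trans (ler_normD _ _) _.
      by rewrite mulr_natl mulr2n lerD2r.
    by rewrite exprMn ler_wpM2l ?exprn_ge0 // lerDr exprn_ge0.
  have /orP[le_fg|le_gf] := le_total `|f w| `|g w|; first exact: key.
  by rewrite [f w + g w]addrC [`|f w| ^+ n + _]addrC; exact: key.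
- by apply: integrableZl => //; apply: integrableD => //; exact: integrable_abse.
Qed.

Lemma has_momentsM f g : has_moments f -> has_moments g ->
  has_moments (fun w => f w * g w).
Proof.
move=> [mf fi] [mg gi]; have mfg : measurable_fun setT (fun w => f w * g w).
  exact: measurable_funM.
split=> // n.
apply: (@le_integrable _ _ _ P setT _ _ (fun w =>
   (f w ^+ (n * 2))%:E + (g w ^+ (n * 2))%:E)%E) => //.
- by apply/measurable_EFinP; exact: measurable_funX.
- move=> w _; rewrite /= lee_fin; apply: le_trans (ler_norm _).
  rewrite exprMn normrM !exprM -[(f w ^+ n) ^+ 2]real_normK ?num_real // -[(g w ^+ n) ^+ 2]real_normK ?num_real //.
  by move: `|f w ^+ n| `|g w ^+ n| => x y; have := sqr_ge0 (x - y);
    have := sqr_ge0 x; have := sqr_ge0 y; rewrite sqrrB; lra.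
- exact: integrableD.
Qed.

Lemma gaussian_has_moments Y : centered_gaussian P Y -> has_moments Y.
Proof. by move=> gY; split; [case: gY|case: (gaussian_moments gY)]. Qed.

Local Notation Er f := (fine 'E_P[f]).

Lemma fine_expectationD f g : has_moments f -> has_moments g ->
  Er (fun w => f w + g w) = Er f + Er g.
Proof.
move=> /has_moments_integrable fi /has_moments_integrable gi.
rewrite !unlock; exact: RintegralD.
Qed.

Lemma fine_expectationZ (c : R) f : has_moments f ->
  Er (fun w => c * f w) = c * Er f.
Proof. by move=> /has_moments_integrable fi; rewrite !unlock; exact: RintegralZl. Qed.

Local Notation A := (T -> R[i]).
Local Notation E := (cexpectation P).

Definition has_cmoments (F : A) : Prop :=
  has_moments (fun w => complex.Re (F w)) /\ has_moments (fun w => complex.Im (F w)).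
Local Notation D := has_cmoments.

Lemma has_cmoments_cst (c : R[i]) : D (cst c).
Proof. by split; exact: has_moments_cst. Qed.

Lemma has_cmomentsD (F G : A) : D F -> D G -> D (F + G).
Proof.
move=> [F1 F2] [G1 G2].
split.
  have -> : (fun w => complex.Re ((F + G) w)) = (fun w => complex.Re (F w) + complex.Re (G w)).
    by apply/funext => w; rewrite -raddfD.
  exact: has_momentsD.
have -> : (fun w => complex.Im ((F + G) w)) = (fun w => complex.Im (F w) + complex.Im (G w)).
  by apply/funext => w; rewrite -raddfD.
exact: has_momentsD.
Qed.

Lemma has_cmomentsM (F G : A) : D F -> D G -> D (F * G).
Proof.
move=> [F1 F2] [G1 G2].
have Re_M (x y : R[i]) : complex.Re (x * y) = complex.Re x * complex.Re y + -1 * (complex.Im x * complex.Im y).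
  by case: x y => [a b] [a' b'] /=; rewrite mulN1r.
have Im_M (x y : R[i]) : complex.Im (x * y) = complex.Re x * complex.Im y + complex.Im x * complex.Re y.
  by case: x y => [a b] [a' b'].
split.
  rewrite (_ : (fun w => _) = (fun w => complex.Re (F w) * complex.Re (G w) +
     -1 * (complex.Im (F w) * complex.Im (G w)))); last by apply/funext => w; rewrite -Re_M.
  by apply: has_momentsD; [|apply: has_momentsM; [exact: has_moments_cst|]]; exact: has_momentsM.
rewrite (_ : (fun w => _) = (fun w => complex.Re (F w) * complex.Im (G w) +
   complex.Im (F w) * complex.Re (G w))); last by apply/funext => w; rewrite -Im_M.
by apply: has_momentsD; exact: has_momentsM.
Qed.

Lemma cexpectationD (F G : A) : D F -> D G -> E (F + G) = E F + E G.
Proof.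
move=> [F1 F2] [G1 G2]; rewrite /cexpectation.
have -> : (fun w => complex.Re ((F + G) w)) = (fun w => complex.Re (F w) + complex.Re (G w)).
  by apply/funext => w; rewrite -raddfD.
have -> : (fun w => complex.Im ((F + G) w)) = (fun w => complex.Im (F w) + complex.Im (G w)).
  by apply/funext => w; rewrite -raddfD.
by rewrite !fine_expectationD.
Qed.

Lemma cexpectationZ (c : R[i]) (F : A) : D F -> E (cst c * F) = c * E F.
Proof.
move=> [F1 F2]; rewrite /cexpectation; case: c => a b.
have -> : (fun w => complex.Re ((cst (a +i* b) * F) w)) =
          (fun w => a * complex.Re (F w) + - b * complex.Im (F w)).
  by apply/funext => w; transitivity (complex.Re ((a +i* b) * F w)) => //; case: (F w) => x y /=; rewrite mulNr.
have -> : (fun w => complex.Im ((cst (a +i* b) * F) w)) =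
          (fun w => a * complex.Im (F w) + b * complex.Re (F w)).
  by apply/funext => w; transitivity (complex.Im ((a +i* b) * F w)) => //; case: (F w) => x y.
rewrite !fine_expectationD ?fine_expectationZ //; try by apply: has_momentsM => //; exact: has_moments_cst.
by apply/eqP; rewrite eq_complex /= mulNr !eqxx.
Qed.

Lemma cexpectation_cst (c : R[i]) : E (cst c) = c.
Proof.
have Ecst (a : R) : fine 'E_P[fun=> a] = a by rewrite (expectation_cst P a).
by case: c => a b; rewrite /cexpectation /= !Ecst.
Qed.

Lemma has_cmoments_sum (I : Type) (r : seq I) (Q : pred I) (F : I -> A) :
  (forall i, Q i -> D (F i)) -> D (\sum_(i <- r | Q i) F i).
Proof. by move=> DF; elim/big_ind: _ => //; [exact: (has_cmoments_cst 0)|exact: has_cmomentsD]. Qed.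

Lemma has_cmoments_prod (I : Type) (r : seq I) (Q : pred I) (F : I -> A) :
  (forall i, Q i -> D (F i)) -> D (\prod_(i <- r | Q i) F i).
Proof. by move=> DF; elim/big_ind: _ => //; [exact: (has_cmoments_cst 1)|exact: has_cmomentsM]. Qed.

Lemma cexpectation_sum (I : Type) (r : seq I) (Q : pred I) (F : I -> A) :
  (forall i, Q i -> D (F i)) -> E (\sum_(i <- r | Q i) F i) = \sum_(i <- r | Q i) E (F i).
Proof.
move=> DF; elim: r => [|i r IH]; first by rewrite !big_nil; exact: (cexpectation_cst 0).
rewrite !big_cons; case: ifP => // Qi; rewrite cexpectationD ?IH //; first exact: DF.
exact: has_cmoments_sum.
Qed.

End AllMoments.

(** * The Wick formula and integration by parts *)

(** A nonzero polynomial has finitely many roots. *)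
Lemma poly_eq_on_nat (C : numFieldType) (p q : {poly C}) :
  (forall k : nat, p.[k%:R] = q.[k%:R]) -> p = q.
Proof.
move=> epq; apply/eqP; rewrite -subr_eq0; apply/negPn/negP => nz.
have u : uniq [seq k%:R : C | k <- iota 0 (size (p - q))].
  by rewrite map_inj_uniq ?iota_uniq // => a b /eqP; rewrite eqr_nat => /eqP.
suff /(max_poly_roots nz)/(_ u) : all (root (p - q)) [seq k%:R | k <- iota 0 (size (p - q))].
  by rewrite size_map size_iota ltnn.
by apply/allP => _ /mapP[k _ ->]; rewrite /root hornerD hornerN epq subrr.
Qed.

Definition del_nth (X : Type) (j : nat) (s : seq X) := take j s ++ drop j.+1 s.

Section Wick.
Context d (T : measurableType d) (R : realType) (P : probability T R).
Local Notation A := (T -> R[i]).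
Local Notation E := (cexpectation P).
Local Notation D := (has_cmoments P).

(** The polynomial in t whose value is E[Q (Y + t U)^n]; comparing its coefficients
of degree 1 polarizes an identity about powers. *)
Definition binomial_moments (Q Y U : A) (n : nat) : {poly R[i]} :=
  \poly_(k < n.+1) (E (Q * (Y ^+ (n - k) * U ^+ k)) *+ 'C(n, k)).

Lemma has_cmomentsX (F : A) n : D F -> D (F ^+ n).
Proof. by move=> DF; elim: n => [|n IH]; [exact: (has_cmoments_cst P 1)|rewrite exprS; exact: has_cmomentsM]. Qed.

Lemma cst_exp (t : R[i]) n : (cst t : A) ^+ n = cst (t ^+ n).
Proof. by elim: n => // n IH; rewrite !exprS IH. Qed.

Lemma cst_natmul n : (n%:R : A) = cst n%:R.
Proof. by elim: n => // n IH; rewrite -natr1 IH -natr1. Qed.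

Lemma horner_binomial_moments (Q Y U : A) n t : D Q -> D Y -> D U ->
  (binomial_moments Q Y U n).[t] = E (Q * (Y + cst t * U) ^+ n).
Proof.
move=> DQ DY DU; rewrite horner_poly exprDn mulr_sumr cexpectation_sum; last first.
  move=> i _; rewrite -mulr_natr cst_natmul.
  exact: has_cmomentsM DQ (has_cmomentsM (has_cmomentsM (has_cmomentsX _ DY) (has_cmomentsX _ (has_cmomentsM (has_cmoments_cst P t) DU))) (has_cmoments_cst P _)).
apply: eq_bigr => k _; rewrite exprMn cst_exp -mulr_natr cst_natmul.
have -> : Q * (Y ^+ (n - k) * (cst (t ^+ k) * U ^+ k) * cst 'C(n, k)%:R) =
   cst (t ^+ k * 'C(n, k)%:R) * (Q * (Y ^+ (n - k) * U ^+ k)).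
  have -> : (cst (t ^+ k * 'C(n, k)%:R) : A) = cst (t ^+ k) * cst 'C(n, k)%:R by [].
  move: (cst _ : A) (cst _ : A) => a b; ring.
rewrite (cexpectationZ _ (has_cmomentsM DQ (has_cmomentsM (has_cmomentsX _ DY) (has_cmomentsX _ DU)))).
by rewrite -mulr_natr; move: (E _) => e; ring.
Qed.

Lemma binomial_moments0 Q Y U n : (binomial_moments Q Y U n)`_0 = E (Q * Y ^+ n).
Proof. by rewrite coef_poly /= subn0 expr0 mulr1 bin0. Qed.

Lemma binomial_moments1 Q Y U n :
  (binomial_moments Q Y U n)`_1 = n%:R * E (Q * U * Y ^+ n.-1).
Proof.
rewrite coef_poly; case: n => [|n]; first by rewrite mul0r.
rewrite /= subSS subn0 expr1 bin1 mulr_natl; congr (E _ *+ _).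
by rewrite [Y ^+ n * U]mulrC mulrA.
Qed.

Lemma cexpectation_real (f : T -> R) : E (fun w => (f w)%:C) = (fine 'E_P[f])%:C.
Proof. by rewrite /cexpectation /= (expectation_cst P 0). Qed.

Section Family.
Variables (I : Type) (Z : I -> A).
Hypothesis hZ : centered_gaussian_family P Z.

Definition gaussian_span (F : A) : Prop :=
  exists s : seq (R[i] * I), F = fun w => \sum_(p <- s) p.1 * Z p.2 w.
Local Notation G := gaussian_span.

Lemma gaussian_spanZ c F : G F -> G (cst c * F).
Proof.
move=> [s ->]; exists [seq (c * p.1, p.2) | p <- s]; apply/funext => w.
rewrite big_map [LHS]mulr_sumr; apply: eq_bigr => p _ /=; exact: mulrA.
Qed.

Lemma gaussian_spanD F F' : G F -> G F' -> G (F + F').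
Proof. by move=> [s ->] [s' ->]; exists (s ++ s'); apply/funext => w; rewrite big_cat. Qed.

Lemma gaussian_span_gen i : G (Z i).
Proof. by exists [:: (1, i)]; apply/funext => w; rewrite big_seq1 mul1r. Qed.

Lemma gaussian_span_Re F : G F -> centered_gaussian P (fun w => complex.Re (F w)).
Proof. by case=> s ->; exact: hZ. Qed.

Lemma Im_mulNi (x : R[i]) : complex.Im x = complex.Re (-'i * x).
Proof. by case: x => a b /=; rewrite !(oppr0, mul0r, mulN1r, opprK, add0r). Qed.

(** Im F is the real part of - i F. *)
Lemma gaussian_span_Im F : G F -> centered_gaussian P (fun w => complex.Im (F w)).
Proof.
move=> /(gaussian_spanZ (-'i)) /gaussian_span_Re; congr centered_gaussian.
by apply/funext => w; rewrite Im_mulNi.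
Qed.

Lemma gaussian_span_has_cmoments F : G F -> D F.
Proof.
by move=> GF; split; apply: gaussian_has_moments; [exact: gaussian_span_Re|exact: gaussian_span_Im].
Qed.

(** For real t, the variable Re Y + t Im Y is a real Gaussian, so the recursion of
gaussian_moments holds for it; both sides are polynomials in t, and the value
at t = i is the assertion. *)
Lemma gaussian_span_moments Y n : G Y ->
  E (Y ^+ n.+1) = n%:R * E (Y ^+ 2) * E (Y ^+ n.-1).
Proof.
move=> GY; pose U : A := fun w => (complex.Re (Y w))%:C.
pose V : A := fun w => (complex.Im (Y w))%:C.
have [mU mV] := gaussian_span_has_cmoments GY.
have DU : D U by split=> //; exact: has_moments_cst.
have DV : D V by split=> //; exact: has_moments_cst.
have YE : Y = U + cst 'i * V.
  by apply/funext => w; rewrite {1}[Y w]complexE.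
have EX n' t : (binomial_moments 1 U V n').[t] = E ((U + cst t * V) ^+ n').
  by rewrite horner_binomial_moments ?mul1r //; exact: (has_cmoments_cst P 1).
rewrite {1 2 3}YE -!EX -mulrA -hornerM -hornerZ; congr (_.[_]).
apply: poly_eq_on_nat => k; rewrite hornerZ hornerM !EX.
(* the value of both polynomials at a real t = k is a statement on the real
   Gaussian variable y *)
pose y w := complex.Re (Y w) + k%:R * complex.Im (Y w).
have gy : centered_gaussian P y.
  have := gaussian_span_Re (gaussian_spanD GY (gaussian_spanZ (k%:R * -'i) GY)).
  congr centered_gaussian; apply/funext => w; rewrite /y Im_mulNi.
  rewrite [(Y + _) w]/(_ + _ * _) raddfD /= -mulrA; congr (_ + _).
  by rewrite !mulr_natl raddfMn.
have UVE m : (U + cst k%:R * V) ^+ m = (fun w => (y w ^+ m)%:C).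
  apply/funext => w; elim: m => // m IH; rewrite exprS [LHS]/(_ * _) IH exprS rmorphM.
  by congr (_ * _); rewrite /y rmorphD rmorphM rmorph_nat.
by rewrite !UVE !cexpectation_real (gaussian_moments gy).2 !rmorphM rmorph_nat mulrA.
Qed.

(** Polarization of gaussian_span_moments: compare the coefficients of t in the
recursion for Y + t x. *)
Lemma stein_power x Y n : G x -> G Y ->
  E (x * Y ^+ n) = n%:R * E (x * Y) * E (Y ^+ n.-1).
Proof.
move=> Gx GY; have [Dx DY] := (gaussian_span_has_cmoments Gx, gaussian_span_has_cmoments GY).
elim/ltn_ind: n => n IH.
have := erefl ((binomial_moments 1 Y x n.+1)`_1).
have D1 : D 1 by exact: (has_cmoments_cst P 1).
rewrite {2}(_ : binomial_moments 1 Y x n.+1 =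
  n%:R *: (binomial_moments 1 Y x 2 * binomial_moments 1 Y x n.-1)); last first.
  apply: poly_eq_on_nat => k; rewrite hornerZ hornerM !horner_binomial_moments // !mul1r mulrA.
  by apply: gaussian_span_moments; apply: gaussian_spanD => //; exact: gaussian_spanZ.
rewrite coefZ coefM !big_ord_recl big_ord0 addr0 /= /bump /= !binomial_moments0 !binomial_moments1.
rewrite !mul1r expr1 => H.
(* n + 1 is the coefficient produced by the polarized power *)
have n1 : n.+1%:R != 0 :> R[i] by rewrite pnatr_eq0.
apply: (mulfI n1); rewrite {}H.
case: n n1 IH => [|n] n1 IH; first by rewrite !mul0r mulr0.
rewrite /=; case: n n1 IH => [|n] n1 IH.
  by rewrite !mul0r mulr0 add0r expr0 !mul1r mulrA.
rewrite (IH n) // [E (Y ^+ n.+1)]gaussian_span_moments //= -[n.+3%:R]natr1 -[n.+2%:R]natr1 -[n.+1%:R]natr1.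
by ring.
Qed.

(** The induction replaces one factor Y at a time by an arbitrary U: the statement
for Y + t U and one more power, at degree 1 in t, is the statement with the
additional factor U. *)
Lemma wick_power (L : seq A) x Y n : G x -> G Y -> (forall F, F \in L -> G F) ->
  E (x * \prod_(F <- L) F * Y ^+ n) =
  \sum_(j < size L) E (x * L`_j) * E (\prod_(F <- del_nth j L) F * Y ^+ n) +
  n%:R * E (x * Y) * E (\prod_(F <- L) F * Y ^+ n.-1).
Proof.
elim: L Y n => [|U L IH] Y n Gx GY GL.
  by rewrite big_nil mulr1 big_ord0 add0r !mul1r; exact: stein_power.
have GU : G U by apply: GL; rewrite mem_head.
have {}GL F : F \in L -> G F by move=> FL; apply: GL; rewrite inE FL orbT.
have Dp L' : (forall F, F \in L' -> F \in L) -> D (\prod_(F <- L') F).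
  move=> sL; rewrite big_seq; apply: has_cmoments_prod => F FL.
  by apply: gaussian_span_has_cmoments; apply: GL; exact: sL.
have subL j F : F \in del_nth j L -> F \in L.
  by rewrite mem_cat => /orP[/mem_take|/mem_drop].
have [[Dx DY] DU] := (gaussian_span_has_cmoments Gx, gaussian_span_has_cmoments GY, gaussian_span_has_cmoments GU).
pose PL := \prod_(F <- L) F; have DPL : D PL by exact: Dp.
pose B j := \prod_(F <- del_nth j L) F; have DB j : D (B j) by apply: Dp; exact: subL.
have n1 : n.+1%:R != 0 :> R[i] by rewrite pnatr_eq0.
apply: (mulfI n1).
have := erefl ((binomial_moments (x * PL) Y U n.+1)`_1).
rewrite {2}(_ : binomial_moments (x * PL) Y U n.+1 =
  \sum_(j < size L) E (x * L`_j) *: binomial_moments (B j) Y U n.+1 +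
  n.+1%:R *: (((E (x * Y))%:P + E (x * U) *: 'X) * binomial_moments PL Y U n)); last first.
  apply: poly_eq_on_nat => k; have DxPL : D (x * PL) by exact: has_cmomentsM.
  rewrite hornerD horner_sum hornerZ hornerM !horner_binomial_moments //.
  rewrite IH //; last by apply: gaussian_spanD => //; exact: gaussian_spanZ.
  congr (_ + _).
    by apply: eq_bigr => j _; rewrite hornerZ horner_binomial_moments.
  rewrite hornerD hornerC hornerZ hornerX -mulrA; congr (_ * (_ * _)).
  rewrite mulrDr (cexpectationD (has_cmomentsM Dx DY) (has_cmomentsM Dx (has_cmomentsM (has_cmoments_cst P _) DU))).
  by rewrite [x * (_ * U)]mulrCA (cexpectationZ _ (has_cmomentsM Dx DU)) [_ * k%:R]mulrC.
rewrite binomial_moments1 /= => H.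
rewrite big_cons -/PL [U * PL]mulrC [x * _]mulrA.
rewrite {}H coefD coef_sum coefZ mulrDl coefD coefCM -scalerAl coefZ coefXM /=.
rewrite binomial_moments0 binomial_moments1 big_ord_recl /= {1}/del_nth /= drop0 -/PL.
rewrite (eq_bigr (fun j : 'I__ => n.+1%:R * (E (x * L`_j) * E (B j * U * Y ^+ n)))); last first.
  by move=> j _; rewrite coefZ binomial_moments1 mulrCA.
rewrite -mulr_sumr !mulrDr addrA addrAC [X in X + _ = _]addrC; congr (_ + _ + _).
  by congr (_ * _); apply: eq_bigr => j _; rewrite /= /del_nth /= big_cons -/(B j) [U * B j]mulrC.
by move: (E _) (E _) => e1 e2; ring.
Qed.

(** Wick formula, in the recursive form that contracts the first variable. *)
Lemma wick_recursion (L : seq A) x : G x -> (forall F, F \in L -> G F) ->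
  E (x * \prod_(F <- L) F) =
  \sum_(j < size L) E (x * L`_j) * E (\prod_(F <- del_nth j L) F).
Proof.
move=> Gx GL; have := @wick_power L x x 0 Gx Gx GL.
rewrite expr0 mulr1 !mul0r addr0 => ->.
by apply: eq_bigr => j _; rewrite mulr1.
Qed.

(** F' is the formal derivative, in the direction of x, of an expression of F as a
polynomial in the Gaussian variables, where the derivative of U is the
covariance of x and U. It is a relation since such an expression is not
determined by the random variable F. *)
Inductive derives (x : A) : A -> A -> Prop :=
| derives_cst c : derives x (cst c) 0
| derivesD F F' K K' : derives x F F' -> derives x K K' -> derives x (F + K) (F' + K')
| derives_mul_gen U F F' : G U -> derives x F F' ->
    derives x (U * F) (cst (E (x * U)) * F + U * F').

Lemma derives_eq x F F' F'' : derives x F F' -> F' = F'' -> derives x F F''.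
Proof. by move=> ? <-. Qed.

Lemma derivesZ x c F F' : derives x F F' -> derives x (cst c * F) (cst c * F').
Proof.
move=> dF; elim: F F' / dF => [e|F F' K K' _ dF _ dK|U F F' GU _ dF].
- by rewrite mulr0; exact: (derives_cst x (c * e)).
- by rewrite !mulrDr; exact: derivesD.
- by rewrite mulrDr !(mulrCA (cst c)); exact: derives_mul_gen.
Qed.

Lemma derivesM x F F' K K' : derives x F F' -> derives x K K' ->
  derives x (F * K) (F' * K + F * K').
Proof.
move=> dF dK; elim: F F' / dF => [e|F F' H H' _ dF _ dH|U F F' GU _ dF].
- by rewrite mul0r add0r; exact: derivesZ.
- by rewrite !mulrDl addrACA; exact: derivesD.
- apply: derives_eq; first by rewrite -mulrA; exact: derives_mul_gen GU dF.
  by rewrite mulrDr mulrDl !mulrA addrA.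
Qed.

Lemma derives_gen x U : G U -> derives x U (cst (E (x * U))).
Proof.
move=> GU; have := derives_mul_gen GU (derives_cst x 1).
rewrite (_ : U * cst 1 = U); last exact: mulr1.
move/derives_eq; apply; rewrite mulr0 addr0; exact: mulr1.
Qed.

Lemma derives_sum x (J : Type) (r : seq J) (F F' : J -> A) :
  (forall j, derives x (F j) (F' j)) ->
  derives x (\sum_(j <- r) F j) (\sum_(j <- r) F' j).
Proof.
move=> dF; elim: r => [|j r IH]; first by rewrite !big_nil; exact: (derives_cst x 0).
by rewrite !big_cons; exact: derivesD.
Qed.

Lemma derives_has_cmoments x F F' : derives x F F' -> D F /\ D F'.
Proof.
move=> dF; elim: F F' / dF => [e|F F' H H' _ [? ?] _ [? ?]|U F F' GU _ [? ?]].
- by split; [exact: has_cmoments_cst|exact: (has_cmoments_cst P 0)].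
- by split; exact: has_cmomentsD.
- have DU := gaussian_span_has_cmoments GU; split; first exact: has_cmomentsM.
  by apply: has_cmomentsD; apply: has_cmomentsM => //; exact: has_cmoments_cst.
Qed.

(** The statement is proved together with an additional product of Gaussian
variables: then the case of a product U F is the induction hypothesis for F with
U moved to the additional product. *)
Lemma stein x F F' : G x -> derives x F F' -> E (x * F) = E F'.
Proof.
move=> Gx dF.
suff H L : (forall K, K \in L -> G K) -> E (x * (F * \prod_(K <- L) K)) =
    E (F' * \prod_(K <- L) K) +
    \sum_(j < size L) E (x * L`_j) * E (F * \prod_(K <- del_nth j L) K).
  by have := H [::] (fun _ => ltac:(by [])); rewrite big_nil !mulr1 big_ord0 addr0.
have Dx := gaussian_span_has_cmoments Gx.
have DL L' : (forall F, F \in L' -> G F) -> D (\prod_(F <- L') F).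
  move=> sL; rewrite big_seq; apply: has_cmoments_prod => K KL.
  by apply: gaussian_span_has_cmoments; exact: sL.
have subL L' j K : K \in del_nth j L' -> K \in L'.
  by rewrite mem_cat => /orP[/mem_take|/mem_drop].
have DdL L' j : (forall F, F \in L' -> G F) -> D (\prod_(F <- del_nth j L') F).
  by move=> GL; apply: DL => K /subL; exact: GL.
elim: F F' / dF L => [e|F F' H H' dF IHF dH IHH|U F F' GU dF IH] L GL.
- rewrite mul0r (cexpectation_cst P 0 : E 0 = 0) add0r mulrCA cexpectationZ; last by apply: has_cmomentsM; auto.
  rewrite wick_recursion // mulr_sumr; apply: eq_bigr => j _.
  by rewrite cexpectationZ; auto; rewrite mulrCA.
- have [[? ?] [? ?]] := (derives_has_cmoments dF, derives_has_cmoments dH).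
  have ? := DL L GL.
  rewrite mulrDl mulrDr cexpectationD; try by do !apply: has_cmomentsM.
  rewrite IHF // IHH // mulrDl cexpectationD; try by do !apply: has_cmomentsM.
  rewrite addrACA -big_split; congr (_ + _); apply: eq_bigr => j _ /=.
  by rewrite mulrDl cexpectationD ?mulrDr //; apply: has_cmomentsM => //; exact: DdL.
- have [? ?] := derives_has_cmoments dF; have DU := gaussian_span_has_cmoments GU; have ? := DL L GL.
  rewrite [U * F]mulrC -mulrA.
  have := IH (U :: L); rewrite big_cons => ->; last first.
    by move=> K; rewrite inE => /predU1P[->//|]; exact: GL.
  rewrite /= big_ord_recl /= {1}/del_nth /= drop0.
  rewrite mulrDl cexpectationD; last 2 first.
  - by do !apply: has_cmomentsM => //; exact: has_cmoments_cst.
  - by do !apply: has_cmomentsM.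
  rewrite -mulrA cexpectationZ; last exact: has_cmomentsM.
  rewrite addrCA addrA; congr (_ + _ + _).
    by rewrite mulrA [F' * U]mulrC.
  apply: eq_bigr => j _; rewrite /= /del_nth /= big_cons; congr (_ * E _).
  by rewrite mulrA.
Qed.

End Family.
End Wick.

(** * Wick polynomials and the Schwinger-Dyson equation *)

Section WickWords.
Variables (R : realType) (H : Type) (ip : H -> H -> R) (B : algType R[i]) (x : H -> B).

Fixpoint wick (h : seq H) : B :=
  match h with
  | [::] => 1
  | a :: h1 => match h1 with
               | [::] => x a
               | b :: h2 => x a * wick h1 - (ip a b)%:C *: wick h2
               end
  end.

Lemma wick2 a b h : wick [:: a, b & h] = x a * wick (b :: h) - (ip a b)%:C *: wick h.
Proof. by []. Qed.

Lemma mul_wick a b h : x a * wick (b :: h) = wick [:: a, b & h] + (ip a b)%:C *: wick h.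
Proof. by rewrite wick2 subrK. Qed.

(** By the recursion on the left word, the only new term arises where X(a) meets
W(b v). *)
Lemma wick_mul u a b v : wick (rcons u a) * wick (b :: v) =
  wick (rcons u a ++ b :: v) + (ip a b)%:C *: (wick u * wick v).
Proof.
move: {2}(size u).+1 (ltnSn (size u)) => n; elim: n u => // n IH [|c [|c' u]] lt_n.
- by rewrite [rcons _ _]/= [wick [:: a]]/= mul_wick mul1r.
- rewrite ![rcons _ _]/= wick2 [wick [:: a]]/= mulrBl -mulrA mul_wick mulrDr.
  rewrite -!scalerAr -scalerAl [wick [::]]/= mul1r !cat_cons wick2 cat0s [wick [:: c]]/=.
  by rewrite [LHS]addrAC.
- have E1 := IH (c' :: u) lt_n; have E2 := IH u (ltnW lt_n).
  rewrite !rcons_cons !cat_cons !wick2 !mulrBl -!mulrA -!scalerAl.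
  rewrite rcons_cons cat_cons in E1.
  rewrite E1 E2 mulrDr -scalerAr !scalerDr scalerN !opprD.
  rewrite addrACA; congr (_ + _); congr (_ - _).
  by rewrite !scalerA mulrC.
Qed.

End WickWords.

Section Matrices.
Context (R : realType) (H : lmodType R) (ip : {dot H for (@idfun R)}).
Context d (T : measurableType d) (P : probability T R) (N : nat).
Variable X : H -> T -> 'M[R[i]]_N.+1.
Hypothesis hX : hermitian_gaussian_matrices P ip X.

Local Notation A := (T -> R[i]).
Local Notation E := (cexpectation P).
Local Notation D := (has_cmoments P).
Local Notation Z := (fun p : H * ('I_N.+1 * 'I_N.+1) => fun w => X p.1 w p.2.1 p.2.2).
Local Notation W h w := (wick (fun a b => ip a b) (X^~ w) h).

Definition entry a i j : A := fun w => X a w i j.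

Let hZ : centered_gaussian_family P Z. Proof. by case: hX. Qed.

Lemma entry_span a i j : gaussian_span Z (entry a i j).
Proof. exact: (gaussian_span_gen Z (a, (i, j))). Qed.

Lemma entry_conj a i j : entry a i j = fun w => (entry a j i w)^*.
Proof.
apply/funext => w; rewrite /entry.
have [hh _ _ _] := hX; have /is_hermitianmxP := hh a w.
by rewrite expr0 scale1r => {1}->; rewrite !mxE.
Qed.

Lemma cexpectation_conj (F : A) : D F -> E (fun w => (F w)^*) = (E F)^*.
Proof.
move=> [_ mI]; rewrite /cexpectation.
have -> : (fun w => complex.Re (F w)^*) = (fun w => complex.Re (F w)).
  by apply/funext => w; case: (F w).
have -> : (fun w => complex.Im (F w)^*) = (fun w => -1 * complex.Im (F w)).
  by apply/funext => w; rewrite mulN1r; case: (F w).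
by rewrite fine_expectationZ // mulN1r.
Qed.

(** The hypotheses give the covariances of entries on or above the diagonal only;
hermitian symmetry transports them to the other entries. *)
Lemma entry_cov a b i j k l : E (entry a i j * entry b k l) =
  N.+1%:R^-1 * (ip a b)%:C * ((k == j)%:R * (l == i)%:R).
Proof.
have [_ _ h0 h1] := hX.
have ipC : ip a b = ip b a by rewrite hermC /= expr0 mul1r.
have [/andP[le_ij le_lk]|n1] := boolP ((i <= j)%N && (l <= k)%N).
  rewrite [entry b k l]entry_conj [LHS]h1 // [k == j]eq_sym [l == i]eq_sym.
  by rewrite mulrC [X in _ * X]mulrC.
have [/andP[le_ji le_kl]|n2] := boolP ((j <= i)%N && (k <= l)%N).
  rewrite [entry a i j * _]mulrC [entry a i j]entry_conj [LHS]h1 // -ipC.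
  exact: mulrC.
have -> : (k == j)%:R * (l == i)%:R = 0 :> R[i].
  have [Ekj|] := eqVneq k j; last by rewrite mul0r.
  have [Eli|] := eqVneq l i; last by rewrite mulr0.
  by move: n1 n2; rewrite Ekj Eli !andbb; case: leqP => // /ltnW ->.
rewrite mulr0; have [lt_ij|le_ji] := ltnP i j.
  move: n1; rewrite (ltnW lt_ij) /= -ltnNge => lt_kl.
  by rewrite [LHS]h0.
move: n2; rewrite le_ji /= -ltnNge => lt_lk.
have lt_ji : (j < i)%N by rewrite ltn_neqAle le_ji andbT; apply: contraNneq n1 => ->; rewrite leqnn ltnW.
rewrite [entry a i j]entry_conj [entry b k l]entry_conj.
transitivity (E (fun w => ((entry a j i * entry b l k) w)^*)).
  by congr cexpectation; apply/funext => w; rewrite rmorphM.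
rewrite cexpectation_conj; last by apply: has_cmomentsM; apply: (gaussian_span_has_cmoments hZ); exact: entry_span.
by rewrite [X in X^*]h0 ?rmorph0.
Qed.

Definition wick_entry h i j : A := fun w => W h w i j.

Lemma wick_entry_nil i j : wick_entry [::] i j = cst (i == j)%:R.
Proof. by apply/funext => w; rewrite /wick_entry /= mxE. Qed.

Lemma wick_entry1 a i j : wick_entry [:: a] i j = entry a i j.
Proof. by []. Qed.

Lemma wick_entry2 a b h i j : wick_entry [:: a, b & h] i j =
  \sum_m entry a i m * wick_entry (b :: h) m j + cst (- (ip a b)%:C) * wick_entry h i j.
Proof.
apply/funext => w; rewrite /wick_entry wick2 !mxE fct_sumE.
by rewrite mulNr.
Qed.

Local Notation cov a b := (N.+1%:R^-1 * (ip a b)%:C : R[i]).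
Local Notation derives := (derives P Z).

Lemma derives_entry a i j b k l :
  derives (entry a i j) (entry b k l) (cst (cov a b * ((k == j)%:R * (l == i)%:R))).
Proof. by rewrite -entry_cov; apply: derives_gen => //; exact: entry_span. Qed.

Definition wick_derivative a i j h k l : A :=
  \sum_(p < size h) cst (cov a h`_p) *
     (wick_entry (take p h) k j * wick_entry (drop p.+1 h) i l).

(** Cutting b c h at a letter: the cut at b comes from X(b), the cut at c from X(b) W(c h)
alone, and at a later letter the two terms of the recursion recombine into
the Wick polynomial of the left part. *)
Lemma derives_wick a i j h k l :
  derives (entry a i j) (wick_entry h k l) (wick_derivative a i j h k l).
Proof.
move: {2}(size h).+1 (ltnSn (size h)) => n; elim: n h k l => // n IH [|b [|c h]] k l lt_n.
- by rewrite /wick_derivative big_ord0 wick_entry_nil; exact: derives_cst.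
- rewrite wick_entry1; apply: derives_eq (derives_entry _ _ _ _ _ _) _.
  rewrite /wick_derivative big_ord_recl big_ord0 addr0 /= !wick_entry_nil.
  by rewrite [i == l]eq_sym.
- rewrite wick_entry2; apply: derives_eq.
    apply: derivesD.
      apply: derives_sum => m; apply: derivesM; [exact: derives_entry|exact: (IH (c :: h))].
    by apply: derivesZ; apply: IH; exact: ltnW.
  rewrite [RHS]big_ord_recl big_split /= (bigD1 i) //= eqxx mulr1 big1 ?addr0; last first.
    by move=> m /negPf ne_mi; rewrite ne_mi !mulr0 (mul0r (_ : A)).
  rewrite ?wick_entry_nil ?drop0 -addrA; congr (_ + _); first by rewrite mulrA.
  under eq_bigr do rewrite mulr_sumr.
  rewrite exchange_big big_ord_recl [RHS]big_ord_recl /= -addrA; congr (_ + _).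
    rewrite ?drop0 ?take0 ?wick_entry1 (bigD1 j) //= big1 ?addr0; last first.
      by move=> m /negPf ne_mj; rewrite wick_entry_nil ne_mj !(mul0r (_ : A)) !mulr0.
    by rewrite wick_entry_nil eqxx [cst 1 * _]mul1r mulrCA.
  rewrite mulr_sumr -big_split /=; apply: eq_bigr => p _ /=.
  rewrite /bump /= !add0n wick_entry2 mulrDl mulrDr mulr_suml mulr_sumr; congr (_ + _).
    by apply: eq_bigr => m _; rewrite mulrCA !mulrA.
  by rewrite mulrCA !mulrA.
Qed.

Lemma wick_entry_has_cmoments h i j : D (wick_entry h i j).
Proof. by have [] := derives_has_cmoments hZ (derives_wick 0 i j h i j). Qed.

Definition wick_trace h : A := fun w => \tr (W h w).

Lemma wick_traceE h : wick_trace h = \sum_i wick_entry h i i.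
Proof. by apply/funext => w; rewrite fct_sumE. Qed.

Definition wick_entry_mul u v i j : A := fun w => (W u w * W v w) i j.

Lemma wick_entry_mulE u v i j :
  wick_entry_mul u v i j = \sum_k wick_entry u i k * wick_entry v k j.
Proof. by apply/funext => w; rewrite fct_sumE /wick_entry_mul mxE. Qed.

(** The trace that appears when one word is cut and glued into another one. *)
Definition wick_trace3 u v z : A := fun w => \tr (W u w * (W v w * W z w)).

Lemma wick_trace3E u v z : wick_trace3 u v z =
  \sum_i \sum_j wick_entry u j i * wick_entry_mul v z i j.
Proof.
apply/funext => w; rewrite exchange_big !fct_sumE; apply: eq_bigr => j _.
by rewrite fct_sumE mxE.
Qed.

Lemma wick_trace_has_cmoments h : D (wick_trace h).
Proof. by rewrite wick_traceE; apply: has_cmoments_sum => i _; exact: wick_entry_has_cmoments. Qed.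

Lemma wick_trace3_has_cmoments u v z : D (wick_trace3 u v z).
Proof.
rewrite wick_trace3E; do 2 (apply: has_cmoments_sum => ? _); rewrite wick_entry_mulE.
apply: has_cmomentsM; first exact: wick_entry_has_cmoments.
by apply: has_cmoments_sum => k _; apply: has_cmomentsM; exact: wick_entry_has_cmoments.
Qed.

Definition wick_traces (L : seq (seq H)) : A := \prod_(g <- L) wick_trace g.

Lemma wick_traces_has_cmoments L : D (wick_traces L).
Proof. by apply: has_cmoments_prod => g _; exact: wick_trace_has_cmoments. Qed.

Definition trace_derivative a i j h : A :=
  \sum_(p < size h) cst (cov a h`_p) * wick_entry_mul (drop p.+1 h) (take p h) i j.

Lemma derives_trace a i j h :
  derives (entry a i j) (wick_trace h) (trace_derivative a i j h).
Proof.
rewrite wick_traceE; apply: derives_eq.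
  by apply: derives_sum => k; exact: derives_wick.
rewrite exchange_big; apply: eq_bigr => p _; rewrite -mulr_sumr wick_entry_mulE.
by congr (_ * _); apply: eq_bigr => k _; rewrite mulrC.
Qed.

Lemma derives_traces a i j L :
  derives (entry a i j) (wick_traces L)
    (\sum_(q < size L) trace_derivative a i j (nth [::] L q) * wick_traces (del_nth q L)).
Proof.
elim: L => [|g L IH]; first by rewrite /wick_traces big_nil big_ord0; exact: derives_cst.
rewrite {1}/wick_traces big_cons; apply: derives_eq (derivesM (derives_trace a i j g) IH) _.
rewrite big_ord_recl /= {2}/del_nth /= drop0; congr (_ + _).
rewrite mulr_sumr; apply: eq_bigr => q _.
by rewrite /wick_traces /del_nth /= big_cons mulrCA.
Qed.

Definition leading_trace a h : A := fun w => \tr (X a w * W h w).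

(** Integration by parts in each entry X(a)_ij of Tr(X(a) W(h)), followed by the
summation over i and j: cutting h separates the indices i and j and gives two
traces, cutting a word of L joins it to h in one trace. *)
Lemma schwinger_dyson a h L : E (leading_trace a h * wick_traces L) =
  \sum_(p < size h) cov a h`_p *
     E (wick_trace (drop p.+1 h) * (wick_trace (take p h) * wick_traces L)) +
  \sum_(q < size L) \sum_(p < size (nth [::] L q)) cov a (nth [::] L q)`_p *
     E (wick_trace3 h (drop p.+1 (nth [::] L q)) (take p (nth [::] L q)) *
        wick_traces (del_nth q L)).
Proof.
have -> : leading_trace a h * wick_traces L =
    \sum_i \sum_j entry a i j * (wick_entry h j i * wick_traces L).
  under eq_bigr do under eq_bigr do rewrite mulrA.
  under eq_bigr do rewrite -mulr_suml; rewrite -mulr_suml; congr (_ * _).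
  apply/funext => w; rewrite fct_sumE; apply: eq_bigr => i _.
  by rewrite fct_sumE mxE.
have De i j : D (entry a i j) by apply: (gaussian_span_has_cmoments hZ); exact: entry_span.
have dF i j := derivesM (derives_wick a i j h j i) (derives_traces a i j L).
rewrite cexpectation_sum; last first.
  move=> i _; apply: has_cmoments_sum => j _; apply: has_cmomentsM (De _ _) _.
  by apply: has_cmomentsM; [exact: wick_entry_has_cmoments|exact: wick_traces_has_cmoments].
under eq_bigr => i _.
  rewrite cexpectation_sum; last first.
    move=> j _; apply: has_cmomentsM (De _ _) _.
    by apply: has_cmomentsM; [exact: wick_entry_has_cmoments|exact: wick_traces_has_cmoments].
  under eq_bigr => j _ do rewrite (stein hZ (entry_span a i j) (dF i j)).
  rewrite -cexpectation_sum; last by move=> j _; have [] := derives_has_cmoments hZ (dF i j).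
  over.
rewrite -cexpectation_sum; last first.
  by move=> i _; apply: has_cmoments_sum => j _; have [] := derives_has_cmoments hZ (dF i j).
have Dt3 u v z L' : D (wick_trace3 u v z * wick_traces L').
  by apply: has_cmomentsM; [exact: wick_trace3_has_cmoments|exact: wick_traces_has_cmoments].
have Dt2 u v L' : D (wick_trace u * (wick_trace v * wick_traces L')).
  by apply: has_cmomentsM; [|apply: has_cmomentsM]; [exact: wick_trace_has_cmoments|exact: wick_trace_has_cmoments|exact: wick_traces_has_cmoments].
transitivity (E (\sum_(p < size h) cst (cov a h`_p) *
     (wick_trace (drop p.+1 h) * (wick_trace (take p h) * wick_traces L)) +
  \sum_(q < size L) \sum_(p < size (nth [::] L q)) cst (cov a (nth [::] L q)`_p) *
     (wick_trace3 h (drop p.+1 (nth [::] L q)) (take p (nth [::] L q)) *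
        wick_traces (del_nth q L)))); last first.
  rewrite cexpectationD; last 2 first.
  - by apply: has_cmoments_sum => p _; apply: has_cmomentsM; [exact: has_cmoments_cst|exact: Dt2].
  - by do 2 (apply: has_cmoments_sum => ? _); apply: has_cmomentsM; [exact: has_cmoments_cst|exact: Dt3].
  congr (_ + _).
    rewrite cexpectation_sum; last by move=> p _; apply: has_cmomentsM; [exact: has_cmoments_cst|exact: Dt2].
    by apply: eq_bigr => p _; rewrite cexpectationZ.
  rewrite cexpectation_sum; last first.
    by move=> q _; apply: has_cmoments_sum => p _; apply: has_cmomentsM; [exact: has_cmoments_cst|exact: Dt3].
  apply: eq_bigr => q _; rewrite cexpectation_sum; last first.
    by move=> p _; apply: has_cmomentsM; [exact: has_cmoments_cst|exact: Dt3].
  by apply: eq_bigr => p _; rewrite cexpectationZ.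
congr cexpectation.
under eq_bigr do rewrite big_split; rewrite big_split /=; congr (_ + _).
  under eq_bigr do under eq_bigr do rewrite mulr_suml.
  under eq_bigr do rewrite exchange_big /=.
  rewrite exchange_big; apply: eq_bigr => p _ /=.
  rewrite [wick_trace _ * _]mulrA !wick_traceE !mulr_suml mulr_sumr.
  apply: eq_bigr => i _; rewrite mulr_sumr !mulr_suml mulr_sumr.
  by apply: eq_bigr => j _; rewrite -mulrA [wick_entry (take _ _) _ _ * _]mulrC.
under eq_bigr do under eq_bigr do rewrite mulr_sumr.
under eq_bigr do rewrite exchange_big /=.
rewrite exchange_big; apply: eq_bigr => q _ /=.
under eq_bigr do under eq_bigr do rewrite mulr_suml mulr_sumr.
under eq_bigr do rewrite exchange_big /=.
rewrite exchange_big; apply: eq_bigr => p _ /=.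
rewrite wick_trace3E mulr_suml mulr_sumr; apply: eq_bigr => i _.
by rewrite mulr_suml mulr_sumr; apply: eq_bigr => j _; ring.
Qed.

End Matrices.

(** * Sequences and products of Wick polynomials *)

Section Sequences.
Variable R : realType.
Local Notation C := (R[i]).

Definition bounded_seq (a : nat -> C) : Prop := exists M : C, forall N, `|a N| <= M.
(** The topology of the complex numbers is carried by the regular module R[i]^o. *)
Definition tends (a : nat -> C) (l : C) : Prop := (a : nat -> C^o) @ \oo --> (l : C^o).

Lemma bounded_cst c : bounded_seq (fun=> c).
Proof. by exists `|c|. Qed.

Lemma boundedD a b : bounded_seq a -> bounded_seq b -> bounded_seq (fun N => a N + b N).
Proof.
move=> [M aM] [M' bM]; exists (M + M') => N.
by apply: le_trans (ler_normD _ _) _; exact: lerD.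
Qed.

Lemma boundedM a b : bounded_seq a -> bounded_seq b -> bounded_seq (fun N => a N * b N).
Proof.
move=> [M aM] [M' bM]; exists (M * M') => N.
by rewrite normrM; exact: ler_pM.
Qed.

Lemma bounded_sum (I : Type) (r : seq I) (Q : pred I) (a : I -> nat -> C) :
  (forall i, Q i -> bounded_seq (a i)) -> bounded_seq (fun N => \sum_(i <- r | Q i) a i N).
Proof.
move=> ba; elim: r => [|i r IH].
  by rewrite (_ : (fun N => _) = (fun=> 0)); [exact: bounded_cst|apply/funext => N; rewrite big_nil].
rewrite (_ : (fun N => _) = (fun N => (if Q i then a i N else 0) + \sum_(i <- r | Q i) a i N)); last first.
  by apply/funext => N; rewrite big_cons; case: ifP => // _; rewrite add0r.
by apply: boundedD => //; case Qi: (Q i); [exact: ba|exact: bounded_cst].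
Qed.

Lemma bounded_inv : bounded_seq (fun N => N.+1%:R^-1).
Proof.
exists 1 => N; rewrite ger0_norm ?invr_ge0 ?ler0n //.
by rewrite invf_le1 ?ltr0n // ler1n.
Qed.

Lemma tends_cst c : tends (fun=> c) c.
Proof. exact: cvg_cst. Qed.

Lemma tendsD a b l m : tends a l -> tends b m -> tends (fun N => a N + b N) (l + m).
Proof. by move=> al bm; exact: (cvgD al bm). Qed.

Lemma tendsM a b l m : tends a l -> tends b m -> tends (fun N => a N * b N) (l * m).
Proof. by move=> al bm; exact: (cvgM al bm). Qed.

Lemma tendsZ c a l : tends a l -> tends (fun N => c * a N) (c * l).
Proof. by apply: tendsM; exact: tends_cst. Qed.

Lemma tends_sum (I : Type) (r : seq I) (Q : pred I) (a : I -> nat -> C) (l : I -> C) :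
  (forall i, Q i -> tends (a i) (l i)) ->
  tends (fun N => \sum_(i <- r | Q i) a i N) (\sum_(i <- r | Q i) l i).
Proof.
move=> al; elim: r => [|i r IH].
  by rewrite big_nil (_ : (fun N => _) = (fun=> 0)); [exact: tends_cst|apply/funext => N; rewrite big_nil].
rewrite (_ : (fun N => _) = (fun N => (if Q i then a i N else 0) + \sum_(i <- r | Q i) a i N)); last first.
  by apply/funext => N; rewrite big_cons; case: ifP => // _; rewrite add0r.
rewrite (_ : \sum_(j <- i :: r | Q j) l j = (if Q i then l i else 0) + \sum_(i <- r | Q i) l i); last first.
  by rewrite big_cons; case: ifP => // _; rewrite add0r.
have ali : tends (fun N => if Q i then a i N else 0) (if Q i then l i else 0).
  by case Qi: (Q i); [exact: al|exact: tends_cst].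
exact: tendsD ali IH.
Qed.

Lemma tends_bounded_div a : bounded_seq a -> tends (fun N => N.+1%:R^-1 * a N) 0.
Proof.
move=> [M aM]; apply/cvgr0Pnorm_le => e e0; near=> N.
rewrite normrM ger0_norm ?invr_ge0 ?ler0n // ler_pdivrMl ?ltr0n //.
apply: le_trans (aM N) _.
have eR : e \is Num.real by rewrite gtr0_real.
have MR : 0 <= M by apply: le_trans (aM 0%N).
rewrite -ler_pdivrMr //.
have : complex.Re (M / e) <= N.+1%:R.
  apply: ltW; apply: lt_le_trans (_ : N%:R <= _); last by rewrite ler_nat.
  by near: N; exact: nbhs_infty_gtr.
have /ger0_real/RRe_real {2}<- : 0 <= M / e by rewrite divr_ge0 // ltW.
by rewrite -lecR rmorph_nat.
Unshelve. all: by end_near. Qed.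

End Sequences.

Section Expansion.
Variables (R : realType) (H : Type) (ip : H -> H -> R).

(** The coefficients depend on the two words only and serve for matrices of any
size, which is what makes bounds on single words uniform. *)
Lemma wick_mul_expand (u v : seq H) : exists r : seq (R[i] * seq H),
  (forall p, p \in [seq size q.2 | q <- r] -> (p <= size u + size v)%N) /\
  forall (B : algType R[i]) (x : H -> B),
    wick ip x u * wick ip x v = \sum_(p <- r) p.1 *: wick ip x p.2.
Proof.
elim/last_ind: u v => [|u a IH] v.
  exists [:: (1, v)]; split; first by move=> p; rewrite inE => /eqP->.
  by move=> B x; rewrite big_seq1 mul1r scale1r.
case: v => [|b v].
  exists [:: (1, rcons u a)]; split; first by move=> p; rewrite inE addn0 => /eqP->.
  by move=> B x; rewrite big_seq1 mulr1 scale1r.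
have [r [sr rE]] := IH v.
exists ((1, rcons u a ++ b :: v) :: [seq ((ip a b)%:C * q.1, q.2) | q <- r]); split.
  move=> p /=; rewrite inE => /predU1P[->|]; first by rewrite size_cat.
  rewrite -map_comp => /sr le_p; apply: leq_trans le_p _.
  by rewrite size_rcons /= addSn addnS leqW // leqW.
move=> B x; rewrite wick_mul big_cons scale1r rE scaler_sumr big_map.
by congr (_ + _); apply: eq_bigr => q _; rewrite scalerA.
Qed.

Lemma wick_mul3_expand (u v z : seq H) : exists r : seq (R[i] * seq H),
  (forall p, p \in [seq size q.2 | q <- r] -> (p <= size u + (size v + size z))%N) /\
  forall (B : algType R[i]) (x : H -> B),
    wick ip x u * (wick ip x v * wick ip x z) = \sum_(p <- r) p.1 *: wick ip x p.2.
Proof.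
have [r [sr rE]] := wick_mul_expand v z.
suff [r' [sr' rE']] : exists r' : seq (R[i] * seq H),
  (forall p, p \in [seq size q.2 | q <- r'] -> (p <= size u + (size v + size z))%N) /\
  forall (B : algType R[i]) (x : H -> B),
    wick ip x u * \sum_(p <- r) p.1 *: wick ip x p.2 = \sum_(p <- r') p.1 *: wick ip x p.2.
  by exists r'; split=> // B x; rewrite rE rE'.
elim: r sr {rE} => [|[c s] r IH] sr.
  by exists [::]; split=> // B x; rewrite !big_nil mulr0.
have [|r' [sr' rE']] := IH; first by move=> p pr; apply: sr; rewrite inE pr orbT.
have [r'' [sr'' rE'']] := wick_mul_expand u s.
exists ([seq (c * q.1, q.2) | q <- r''] ++ r'); split.
  move=> p; rewrite map_cat mem_cat -map_comp => /orP[/sr''|/sr'//].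
  by move/leq_trans; apply; rewrite leq_add2l; apply: sr; rewrite mem_head.
move=> B x; rewrite big_cons mulrDr rE' big_cat big_map /=; congr (_ + _).
rewrite -scalerAr rE'' scaler_sumr; apply: eq_bigr => q _; exact: scalerA.
Qed.

Definition word_dot (u v : seq H) : R :=
  if size u == size v then \prod_(p <- zip u v) ip p.1 p.2 else 0.

Lemma word_dot_rcons u a v b : word_dot (rcons u a) (rcons v b) = word_dot u v * ip a b.
Proof.
rewrite /word_dot !size_rcons eqSS; case: eqP => [Es|]; last by rewrite mul0r.
by rewrite zip_rcons // -cats1 big_cat big_seq1.
Qed.

End Expansion.

(** * Uniform bounds on trace moments *)

Section Asymptotics.
Context (R : realType) (H : lmodType R) (ip : {dot H for (@idfun R)}).
Context (d : nat -> measure_display) (T : forall N, measurableType (d N))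
  (P : forall N, probability (T N) R).
Variable X : forall N, H -> T N -> 'M[R[i]]_N.+1.
Hypothesis hX : forall N, hermitian_gaussian_matrices (P N) ip (@X N).

Local Notation E N := (cexpectation (P N)).
Local Notation tr N := (wick_trace ip (@X N)).
Local Notation tr3 N := (wick_trace3 ip (@X N)).
Local Notation trs N := (wick_traces ip (@X N)).
Local Notation dimV N := ((N.+1%:R : R[i])^-1).
Local Notation ipf := (fun a b => ip a b).

Implicit Types (h u v : seq H) (L : seq (seq H)).

Definition trace_moment L N : R[i] := E N (trs N L).

Definition total_length L : nat := sumn (map size L).
Definition nonempty_words L : bool := all (fun g => 0 < size g)%N L.

Lemma wick_trace_nil N : tr N [::] = cst N.+1%:R.
Proof. by apply/funext => w; rewrite /wick_trace /= mxtrace1. Qed.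

Lemma trace_moment_nil : trace_moment [::] = fun=> 1.
Proof.
apply/funext => N; rewrite /trace_moment /wick_traces big_nil.
exact: (cexpectation_cst (P N) 1).
Qed.

Lemma wick_traces_cons N h L : trs N (h :: L) = tr N h * trs N L.
Proof. exact: big_cons. Qed.

Lemma total_length_cons g L : total_length (g :: L) = (size g + total_length L)%N.
Proof. by []. Qed.

Lemma total_length_del_nth q L : (q < size L)%N ->
  (size (nth [::] L q) + total_length (del_nth q L) = total_length L)%N.
Proof.
move=> lt_q; rewrite -{3}(cat_take_drop q L) (drop_nth [::] lt_q).
by rewrite /total_length /del_nth !map_cat !sumn_cat /= addnCA.
Qed.

Lemma nonempty_words_del_nth q L : nonempty_words L -> nonempty_words (del_nth q L).
Proof.
rewrite /nonempty_words /del_nth all_cat.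
elim: L q => [|g L IH] [|q] //= /andP[ne_g neL]; first by rewrite drop0 neL.
by rewrite ne_g IH.
Qed.

(** The factor 1/N either is absorbed by Tr 1 = N or is left over. *)
Lemma contract_trace s L N : dimV N * E N (tr N s * trs N L) =
  if s is [::] then trace_moment L N else dimV N * trace_moment (s :: L) N.
Proof.
case: s => [|a s]; last by rewrite -wick_traces_cons.
rewrite wick_trace_nil cexpectationZ; last exact: (wick_traces_has_cmoments (hX N)).
by rewrite mulrA mulVf ?mul1r // pnatr_eq0.
Qed.

(** The subtracted term of W(a h) cancels the cut of h at its first letter, in which
W() contributes the trace N. *)
Lemma trace_moment_cons a h L N : trace_moment ((a :: h) :: L) N =
  \sum_(p < size h | p != 0 :> nat) (ip a h`_p)%:C *
     (dimV N * E N (tr N (drop p.+1 h) * trs N (take p h :: L))) +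
  \sum_(q < size L) \sum_(p < size (nth [::] L q)) (ip a (nth [::] L q)`_p)%:C *
     (dimV N * E N (tr3 N h (drop p.+1 (nth [::] L q)) (take p (nth [::] L q)) *
        trs N (del_nth q L))).
Proof.
have SD := schwinger_dyson (hX N) a h L.
have mulE (x y z : R[i]) : x * (y * z) = y * x * z by rewrite mulrCA mulrA.
have -> : \sum_(q < size L) \sum_(p < size (nth [::] L q)) (ip a (nth [::] L q)`_p)%:C *
     (dimV N * E N (tr3 N h (drop p.+1 (nth [::] L q)) (take p (nth [::] L q)) *
        trs N (del_nth q L))) = E N (leading_trace ip (@X N) a h * trs N L) -
   \sum_(p < size h) (ip a h`_p)%:C *
     (dimV N * E N (tr N (drop p.+1 h) * trs N (take p h :: L))).
  apply/eqP; rewrite eq_sym subr_eq SD addrC; apply/eqP; congr (_ + _).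
  - by apply: eq_bigr => q _; apply: eq_bigr => p _; rewrite -mulrA mulrCA.
  - by apply: eq_bigr => p _; rewrite wick_traces_cons -mulrA mulrCA.
rewrite /trace_moment wick_traces_cons.
case: h {SD} => [|b h].
  rewrite !big_ord0 add0r subr0; congr cexpectation; congr (_ * _).
  by apply/funext => w; rewrite /leading_trace /wick_trace /= mulr1.
(* the cut at p = 0 is split off; its two traces are Tr 1 and the trace that is
   subtracted in W(a b h) *)
have e (x y z : R[i]) : x + (y - (z + x)) = y - z by ring.
rewrite [X in _ = _ + (_ - X)](bigD1 ord0) //= [RHS]e.
have cL := wick_traces_has_cmoments (hX N) L.
have ct h' := wick_trace_has_cmoments (hX N) h'.
rewrite drop0 wick_traces_cons wick_trace_nil.
rewrite [tr N h * _]mulrCA cexpectationZ; last exact: has_cmomentsM.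
rewrite [dimV N * _]mulrA mulVf ?pnatr_eq0 // mul1r.
rewrite -cexpectationZ -?cexpectationB; last exact: has_cmomentsM.
apply/eqP; rewrite eq_sym subr_eq -cexpectationD; last 2 first.
- by apply: has_cmomentsM.
- by apply: has_cmomentsM; [exact: has_cmoments_cst|exact: has_cmomentsM].
apply/eqP; congr cexpectation; rewrite mulrA -mulrDl; congr (_ * _).
apply/funext => w; transitivity (tr N [:: a, b & h] w + (ip a b)%:C * tr N h w) => //.
by rewrite /leading_trace /wick_trace wick2 raddfB /= linearZ /= subrK.
Qed.

Lemma bounded_contract_trace n s L :
  (forall L', nonempty_words L' -> (total_length L' <= n)%N ->
     bounded_seq (trace_moment L')) ->
  nonempty_words L -> (size s + total_length L <= n)%N ->
  bounded_seq (fun N => dimV N * E N (tr N s * trs N L)).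
Proof.
move=> bL neL le_n.
rewrite (_ : (fun N => _) = fun N => if s is [::] then trace_moment L N
    else dimV N * trace_moment (s :: L) N); last first.
  by apply/funext => N; exact: contract_trace.
case: s le_n => [|a s] le_n; first exact: bL.
by apply: boundedM; [exact: bounded_inv|exact: bL].
Qed.

Lemma wick_trace3_expand u v z : exists r : seq (R[i] * seq H),
  (forall p, p \in [seq size q.2 | q <- r] -> (p <= size u + (size v + size z))%N) /\
  forall N L, E N (tr3 N u v z * trs N L) =
    \sum_(p <- r) p.1 * E N (tr N p.2 * trs N L).
Proof.
have [r [sr rE]] := wick_mul3_expand ipf u v z; exists r; split=> // N L.
have -> : tr3 N u v z * trs N L = \sum_(p <- r) cst p.1 * (tr N p.2 * trs N L).
  rewrite (eq_bigr (fun p => cst p.1 * tr N p.2 * trs N L)); last by move=> p _; rewrite mulrA.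
  rewrite -mulr_suml; congr (_ * _); apply/funext => w.
  rewrite fct_sumE /wick_trace3 rE raddf_sum; apply: eq_bigr => p _.
  exact: linearZ.
have cam2 s : has_cmoments (P N) (tr N s * trs N L).
  by apply: has_cmomentsM; [exact: wick_trace_has_cmoments|exact: wick_traces_has_cmoments].
rewrite cexpectation_sum; last by move=> p _; apply: has_cmomentsM; [exact: has_cmoments_cst|exact: cam2].
by apply: eq_bigr => p _; rewrite cexpectationZ.
Qed.

Lemma bounded_trace3 n u v z L :
  (forall L', nonempty_words L' -> (total_length L' <= n)%N ->
     bounded_seq (trace_moment L')) ->
  nonempty_words L -> (size u + (size v + size z) + total_length L <= n)%N ->
  bounded_seq (fun N => dimV N * E N (tr3 N u v z * trs N L)).
Proof.
move=> bL neL le_n; have [r [sr rE]] := wick_trace3_expand u v z.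
rewrite (_ : (fun N => _) =
  fun N => \sum_(p <- r) p.1 * (dimV N * E N (tr N p.2 * trs N L))); last first.
  by apply/funext => N; rewrite rE mulr_sumr; apply: eq_bigr => p _; rewrite mulrCA.
elim: r sr {rE} => [|[c s] r IH] sr.
  rewrite (_ : (fun N => _) = fun=> 0); first exact: bounded_cst.
  by apply/funext => N; rewrite big_nil.
rewrite (_ : (fun N => _) = fun N => c * (dimV N * E N (tr N s * trs N L)) +
  \sum_(p <- r) p.1 * (dimV N * E N (tr N p.2 * trs N L))); last first.
  by apply/funext => N; rewrite big_cons.
apply: boundedD; last by apply: IH => p pr; apply: sr; rewrite inE pr orbT.
apply: boundedM; first exact: bounded_cst.
apply: bounded_contract_trace bL neL _; apply: leq_trans le_n; rewrite leq_add2r.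
by apply: sr; rewrite mem_head.
Qed.

(** Every term of trace_moment_cons involves words of smaller total length, and its
factor 1/N compensates the trace of the possibly empty word that appears. *)
Lemma bounded_trace_moment L : nonempty_words L -> bounded_seq (trace_moment L).
Proof.
move: {2}(total_length L) (leqnn (total_length L)) => n; elim: n L => [|n IH] [|[|a h] L] //.
- by rewrite trace_moment_nil => _ _; exact: bounded_cst.
- by rewrite trace_moment_nil => _ _; exact: bounded_cst.
rewrite total_length_cons [size _]/= addSn ltnS => le_n neL.
rewrite (_ : trace_moment _ = fun N => 
  \sum_(p < size h | p != 0 :> nat) (ip a h`_p)%:C *
     (dimV N * E N (tr N (drop p.+1 h) * trs N (take p h :: L))) +
  \sum_(q < size L) \sum_(p < size (nth [::] L q)) (ip a (nth [::] L q)`_p)%:C *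
     (dimV N * E N (tr3 N h (drop p.+1 (nth [::] L q)) (take p (nth [::] L q)) *
        trs N (del_nth q L)))); last first.
  by apply/funext => N; exact: trace_moment_cons.
apply: boundedD.
  apply: bounded_sum => p p0; apply: boundedM; first exact: bounded_cst.
  apply: (bounded_contract_trace (n := n)) => [L' neL' le_L'||]; first exact: IH.
    by rewrite /nonempty_words /= size_take ltn_ord lt0n p0.
  rewrite total_length_cons size_drop size_take ltn_ord addnA.
  by apply: leq_trans le_n; rewrite leq_add2r -ltnS -addnS subnK.
apply: bounded_sum => q _; apply: bounded_sum => p _.
apply: boundedM; first exact: bounded_cst.
apply: (bounded_trace3 (n := n)) => [L' neL' le_L'||]; first exact: IH.
  exact: nonempty_words_del_nth.
apply: leq_trans le_n; rewrite -addnA leq_add2l size_drop size_take ltn_ord.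
rewrite -(total_length_del_nth (ltn_ord q)) leq_add2r.
by rewrite -ltnS -addnS subnK.
Qed.

End Asymptotics.

(** * Limits of trace moments *)

Lemma wick_cat (R : realType) (H : Type) (ip : H -> H -> R) (B : algType R[i])
  (x : H -> B) (a : H) (u v : seq H) :
  ((0 < size u)%N -> (0 < size v)%N -> ip (last a u) (head a v) = 0) ->
  wick ip x u * wick ip x v = wick ip x (u ++ v).
Proof.
elim/last_ind: u => [_|u c _]; first by rewrite mul1r.
case: v => [_|b v]; first by rewrite mulr1 cats0.
rewrite size_rcons last_rcons /= => orth.
by rewrite wick_mul orth // scale0r addr0.
Qed.

Section Limits.
Context (R : realType) (H : lmodType R) (ip : {dot H for (@idfun R)}).
Context (d : nat -> measure_display) (T : forall N, measurableType (d N))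
  (P : forall N, probability (T N) R).
Variable X : forall N, H -> T N -> 'M[R[i]]_N.+1.
Hypothesis hX : forall N, hermitian_gaussian_matrices (P N) ip (@X N).

Local Notation E N := (cexpectation (P N)).
Local Notation tr N := (wick_trace ip (@X N)).
Local Notation tr3 N := (wick_trace3 ip (@X N)).
Local Notation trs N := (wick_traces ip (@X N)).
Local Notation dimV N := ((N.+1%:R : R[i])^-1).
Local Notation ipf := (fun a b => ip a b).
Local Notation trm := (trace_moment ip P X).
Local Notation W N h w := (wick (fun a b => ip a b) (@X N ^~ w) h).

Implicit Types (h u v : seq H) (L : seq (seq H)).

Lemma tends_eq (a b : nat -> R[i]) l : (forall N, a N = b N) -> tends b l -> tends a l.
Proof. by move=> ab; rewrite (_ : a = b) //; apply/funext. Qed.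

(** Each cut leaves two nonempty words, hence 1/N times a bounded moment, except the
cut at the last letter, whose coefficient is <a, last h> = 0. *)
Lemma tends_off_diagonal a h L : nonempty_words L -> ip a (last a h) = 0 ->
  tends (fun N => \sum_(p < size h | p != 0 :> nat) (ip a h`_p)%:C *
     (dimV N * E N (tr N (drop p.+1 h) * trs N (take p h :: L)))) 0.
Proof.
move=> neL orth.
rewrite [X in tends _ X](_ : 0 = \sum_(p < size h | p != 0 :> nat) 0); last by rewrite big1.
apply: tends_sum => p p0.
have [last_p|lt_p] := leqP (size h) p.+1.
  have Ep : p = (size h).-1 :> nat.
    by apply/eqP; rewrite eqn_leq -ltnS prednK ?ltn_ord ?(leq_ltn_trans _ (ltn_ord p)) //= -subn1 leq_subLR.
  have -> : h`_p = last a h by rewrite Ep (set_nth_default a) ?nth_last // -Ep ltn_ord.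
  by apply: (tends_eq (b := fun=> 0)) => [N|]; [rewrite orth mul0r|exact: tends_cst].
rewrite -[X in tends _ X](mulr0 (ip a h`_p)%:C); apply: tendsZ.
apply: (tends_eq (b := fun N => dimV N * trm (drop p.+1 h :: take p h :: L) N)) => [N|].
  by rewrite (contract_trace hX); case: (drop _ _) (size_drop p.+1 h) => // /esym/eqP; rewrite subn_eq0 leqNgt lt_p.
apply: tends_bounded_div; apply: bounded_trace_moment => //.
by rewrite /nonempty_words /= size_drop subn_gt0 lt_p size_take ltn_ord lt0n p0.
Qed.

Lemma tends_trace_moment1 a h : ip a (last a h) = 0 -> tends (trm [:: a :: h]) 0.
Proof.
move=> orth; have := @tends_off_diagonal a h [::] isT orth; apply: tends_eq => N.
by rewrite (trace_moment_cons hX) big_ord0 addr0.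
Qed.

Definition wick_trace2 N u v : T N -> R[i] := fun w => \tr (W N u w * W N v w).

Lemma trace_momentE1 h N : trm [:: h] N = E N (tr N h).
Proof. by rewrite /trace_moment wick_traces_cons /wick_traces big_nil mulr1. Qed.

Lemma tends_trace1 h : tends (fun N => dimV N * E N (tr N h)) (size h == 0%N)%:R.
Proof.
case: h => [|a h].
  apply: (tends_eq (b := fun=> 1)) => [N|]; last exact: tends_cst.
  by rewrite wick_trace_nil cexpectation_cst mulVf // pnatr_eq0.
apply: (tends_eq (b := fun N => dimV N * trm [:: a :: h] N)) => [N|].
  by rewrite trace_momentE1.
exact/tends_bounded_div/bounded_trace_moment.
Qed.

Arguments tends_trace1 : clear implicits.

Lemma wick_trace2_has_cmoments N u v : has_cmoments (P N) (@wick_trace2 N u v).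
Proof.
have <- : wick_trace3 ip (@X N) [::] u v = @wick_trace2 N u v.
  by apply/funext => w; rewrite /wick_trace3 /= mul1r.
exact: wick_trace3_has_cmoments.
Qed.

(** Peeling one letter off each side of the junction with wick_mul: the trace of a
Wick polynomial of a nonempty word is negligible against N, and the
contraction contributes the inner product. *)
Lemma tends_trace2 u v :
  tends (fun N => dimV N * E N (@wick_trace2 N u v)) (word_dot ipf u (rev v))%:C.
Proof.
elim/last_ind: u v => [|u a IH] v.
  have -> : (word_dot ipf [::] (rev v))%:C = (size v == 0%N)%:R.
    by rewrite /word_dot size_rev eq_sym; case: v => [|b v] //=; rewrite big_nil.
  apply: tends_eq _ (tends_trace1 v) => N; congr (_ * cexpectation _ _).
  by apply/funext => w; rewrite /wick_trace2 mul1r.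
case: v => [|b v].
  have -> : (word_dot ipf (rcons u a) (rev [::]))%:C = (size (rcons u a) == 0%N)%:R.
    by rewrite /word_dot size_rcons.
  apply: tends_eq _ (tends_trace1 (rcons u a)) => N; congr (_ * cexpectation _ _).
  by apply/funext => w; rewrite /wick_trace2 mulr1.
rewrite rev_cons word_dot_rcons [word_dot _ _ _ * _]mulrC rmorphM -[X in tends _ X]add0r.
apply: (tends_eq (b := fun N => dimV N * E N (tr N (rcons u a ++ b :: v)) +
   (ip a b)%:C * (dimV N * E N (@wick_trace2 N u v)))) => [N|]; last first.
  have := tends_trace1 (rcons u a ++ b :: v); rewrite size_cat size_rcons => t1.
  exact: tendsD t1 (tendsZ (IH v)).
rewrite mulrCA -mulrDr -(cexpectationZ (ip a b)%:C); last exact: wick_trace2_has_cmoments.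
rewrite -cexpectationD; last 2 first.
- exact: (wick_trace_has_cmoments (hX N)).
- by apply: has_cmomentsM; [exact: has_cmoments_cst|exact: wick_trace2_has_cmoments].
congr (_ * cexpectation _ _); apply/funext => w.
by rewrite /wick_trace2 wick_mul raddfD /= linearZ.
Qed.

Arguments tends_trace2 : clear implicits.

(** Orthogonality of the ends of g lets the two parts of g, exchanged by the
cut, merge into a single Wick polynomial. *)
Lemma tends_trace_moment2 a h g : ip a (last a h) = 0 -> (0 < size g)%N ->
  ip (last 0 g) (head 0 g) = 0 ->
  tends (trm [:: a :: h; g])
    (\sum_(p < size g) ip a g`_p * word_dot ipf h (rev (drop p.+1 g ++ take p g)))%:C.
Proof.
move=> orth g0 orth_g; rewrite -[X in tends _ X]add0r rmorph_sum.
have neg : nonempty_words [:: g] by rewrite /nonempty_words /= g0.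
apply: tends_eq (fun N => trace_moment_cons hX _ _ _ _) _.
apply: tendsD (tends_off_diagonal neg orth) _.
apply: (tends_eq (b := fun N => \sum_(p < size g) (ip a g`_p)%:C *
  (dimV N * E N (@wick_trace2 N h (drop p.+1 g ++ take p g))))) => [N|]; last first.
  by apply: tends_sum => p _; rewrite rmorphM; apply: tendsZ; exact: tends_trace2.
rewrite big_ord_recl big_ord0 addr0; apply: eq_bigr => p _ /=.
rewrite /wick_traces /= big_nil mulr1; congr (_ * (_ * cexpectation _ _)).
apply/funext => w; rewrite /wick_trace3 /wick_trace2; congr (\tr (_ * _)).
apply: (@wick_cat _ _ _ _ _ 0) => drop0 take0.
rewrite -[RHS]orth_g; congr (ip _ _).
  rewrite -[in RHS](cat_take_drop p.+1 g) last_cat.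
  by case: (drop _ _) drop0.
by rewrite -[in RHS](cat_take_drop p g); case: (take _ _) take0.
Qed.

End Limits.

(** * Chebyshev polynomials and the circular pairing *)

Section Chebyshev.
Variable F : numFieldType.

Lemma chebV0 : chebV F 0 = 1.
Proof. exact: comp_polyC. Qed.

Let double_half : ('X *+ 2 : {poly F}) \Po (2^-1 *: 'X) = 'X.
Proof.
have half : 2^-1 + 2^-1 = 1 :> F by field.
by rewrite mulr2n comp_polyD comp_polyX -scalerDl half scale1r.
Qed.

Lemma chebV1 : chebV F 1 = 'X.
Proof. exact: double_half. Qed.

Lemma chebVSS n : chebV F n.+2 = 'X * chebV F n.+1 - chebV F n.
Proof. by rewrite /chebV /= comp_polyB comp_polyM double_half. Qed.

End Chebyshev.

Section Words.
Variables (R : realType) (H : Type) (ip : H -> H -> R) (N : nat) (x : H -> 'M[R[i]]_N.+1).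

Lemma horner_mx_chebV a n : ip a a = 1 ->
  horner_mx (x a) (chebV _ n) = wick ip x (nseq n a).
Proof.
move=> aa1; suff [] : horner_mx (x a) (chebV _ n) = wick ip x (nseq n a) /\
    horner_mx (x a) (chebV _ n.+1) = wick ip x (nseq n.+1 a) by [].
elim: n => [|n [IH IH1]].
  by rewrite chebV0 chebV1 rmorph1 horner_mx_X.
split=> //; rewrite chebVSS rmorphB rmorphM /= horner_mx_X IH IH1.
by rewrite [RHS]/= aa1 scale1r.
Qed.

Definition block_word k (f : 'I_k -> H) (n : 'I_k -> nat) (s : seq 'I_k) : seq H :=
  flatten [seq nseq (n i) (f i) | i <- s].

Lemma prod_chebV k (f : 'I_k -> H) (n : 'I_k -> nat) (s : seq 'I_k) :
  (forall i, ip (f i) (f i) = 1) -> (forall i, (1 <= n i)%N) ->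
  sorted (fun i j => ip (f i) (f j) == 0) s ->
  \prod_(i <- s) horner_mx (x (f i)) (chebV _ (n i)) = wick ip x (block_word f n s).
Proof.
move=> f1 n1; elim: s => [|i s IH] so; first by rewrite big_nil.
rewrite big_cons IH; last exact: path_sorted so.
rewrite horner_mx_chebV //; apply: (@wick_cat _ _ _ _ _ (f i)) => _.
case: s so {IH} => //= j s /andP[/eqP fij _] _.
have -> : last (f i) (nseq (n i) (f i)) = f i by elim: (n i).
by rewrite /block_word /=; case: (n j) (n1 j).
Qed.

End Words.

Lemma sorted_enum_ord k (r : rel 'I_k) : (forall i, r i (ordS i)) -> sorted r (enum 'I_k).
Proof.
case: k r => [|k] r hr; first by rewrite enum_ord0.
apply/(sortedP ord0) => i; rewrite size_enum_ord => lt_i.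
have lt_i' : (i < k.+1)%N by exact: ltnW.
rewrite (_ : nth ord0 (enum 'I_k.+1) i.+1 = ordS (nth ord0 (enum 'I_k.+1) i)) //.
by apply: val_inj; rewrite /= !nth_enum_ord // modn_small.
Qed.

Section Ends.
Variables (H : Type) (z : H) (k : nat) (f : 'I_k.+1 -> H) (n : 'I_k.+1 -> nat).
Hypothesis n1 : forall i, (1 <= n i)%N.

Lemma head_block_word : head z (block_word f n (enum 'I_k.+1)) = f ord0.
Proof. by rewrite enum_ordSl /block_word /=; case: (n ord0) (n1 ord0). Qed.

Lemma last_block_word : last z (block_word f n (enum 'I_k.+1)) = f ord_max.
Proof.
rewrite enum_ordSr /block_word map_rcons flatten_rcons last_cat.
by case: (n ord_max) (n1 ord_max) => // q _ /=; elim: q.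
Qed.

Lemma block_word_cons : exists h, block_word f n (enum 'I_k.+1) = f ord0 :: h.
Proof.
by rewrite enum_ordSl /block_word /=; case: (n ord0) (n1 ord0) => // q _; eexists.
Qed.

End Ends.

Lemma rev_block_word (H : Type) l (g : 'I_l -> H) (m : 'I_l -> nat) :
  block_word (g \o @rev_ord l) (m \o @rev_ord l) (enum 'I_l) = rev (block_word g m (enum 'I_l)).
Proof.
have rev_enum : [seq rev_ord i | i <- enum 'I_l] = rev (enum 'I_l).
  case: l {g m} => [|l]; first by rewrite enum_ord0.
  apply: (@eq_from_nth _ ord0); first by rewrite size_map size_rev.
  move=> i; rewrite size_map size_enum_ord => lt_i; rewrite (nth_map ord0) ?size_enum_ord //.
  apply: val_inj; rewrite nth_rev ?size_enum_ord //= !nth_enum_ord //.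
  by rewrite ltn_subLR // addSnnS leq_addl.
rewrite /block_word rev_flatten -map_comp -map_rev -rev_enum -map_comp.
congr flatten; apply: eq_map => i /=; apply: (@eq_from_nth _ (g i)); rewrite ?size_rev ?size_nseq //.
by move=> p lt_p; rewrite nth_rev ?size_nseq // !nth_nseq lt_p ltn_subrL (leq_ltn_trans _ lt_p).
Qed.

Section Pairing.
Context (R : realType) (H : lmodType R) (ip : {dot H for (@idfun R)}).
Local Notation ipf := (fun a b => ip a b).

Lemma cplx_dot_embed u v : cplx_dot ip (cplx_embed u) (cplx_embed v) = (ip u v)%:C.
Proof.
rewrite /cplx_dot /cplx_embed /= !linear0l !linear0r.
by rewrite addr0 subr0.
Qed.

Lemma nth_rot_mod (S : Type) (z : S) (s : seq S) k i :
  (k <= size s)%N -> (i < size s)%N -> nth z (rot k s) i = nth z s ((i + k) %% size s).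
Proof.
move=> le_k lt_i; rewrite /rot nth_cat size_drop; case: ltnP => [lt_ik|le_ik].
  by rewrite nth_drop [(i + k)%N]addnC modn_small // -ltn_subRL.
have Ei : (i + k = (i - (size s - k)) + size s)%N by rewrite -{2}(subnK le_k) addnA subnK.
have lt_k : (i - (size s - k) < k)%N by rewrite ltn_subLR // subnK.
by rewrite Ei modnDr modn_small ?nth_take // (leq_trans lt_k).
Qed.

Lemma word_dotE (s t : seq H) : size s = size t ->
  word_dot ipf s t = \prod_(i < size s) ip s`_i t`_i.
Proof.
move=> Est; rewrite /word_dot Est eqxx (big_nth (0, 0)) size_zip Est minnn big_mkord.
by apply: eq_bigr => i _; rewrite nth_zip.
Qed.

(** Index shifts modulo the length are rotations of the word. *)
Lemma cyc_pairing_embed (s t : seq H) :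
  cyc_pairing ip (map (@cplx_embed R H) s) (map (@cplx_embed R H) t) =
  (if size s == size t then \sum_(k < size s) word_dot ipf s (rot k t) else 0)%:C.
Proof.
rewrite /cyc_pairing !size_map; case: eqP => // Est.
rewrite rmorph_sum; apply: eq_bigr => k _ /=.
rewrite word_dotE ?size_rot // rmorph_prod; apply: eq_bigr => i _.
have lt_m : ((i + k) %% size s < size t)%N by rewrite -Est ltn_mod (leq_ltn_trans _ (ltn_ord i)).
rewrite !(nth_map 0) // cplx_dot_embed nth_rot_mod -?Est //.
exact: ltnW.
Qed.

(** Cutting g at p and reversing the exchanged parts is the rotation of the
reversed word that brings g_p to the front; p is matched with the rotation
by the number of letters that follow it. *)
Lemma sum_word_dot_rot a h g :
  (if (size h).+1 == size g then \sum_(k < (size h).+1) word_dot ipf (a :: h) (rot k (rev g)) else 0) =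
  \sum_(p < size g) ip a g`_p * word_dot ipf h (rev (drop p.+1 g ++ take p g)).
Proof.
have szE (p : 'I_(size g)) : size (rev (drop p.+1 g ++ take p g)) = (size g).-1.
  rewrite size_rev size_cat size_drop size_take ltn_ord.
  by rewrite -[in RHS](subnK (ltn_ord p)) addnS.
case: eqP => [Ehg|neq]; last first.
  rewrite big1 // => p _; rewrite /word_dot szE; case: eqP => [Eh|]; last by rewrite mulr0.
  by case: neq; rewrite Eh prednK // (leq_ltn_trans _ (ltn_ord p)).
have Eh : size h = (size g).-1 by rewrite -Ehg.
rewrite Ehg (reindex_inj rev_ord_inj); apply: eq_bigr => p _ /=.
have -> : rot (size g - p.+1) (rev g) = g`_p :: rev (drop p.+1 g ++ take p g).
  rewrite -[in rev g](cat_take_drop p g) (drop_nth 0) // rev_cat rev_cons cat_rcons.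
  by rewrite -{1}(size_drop p.+1 g) -(size_rev (drop p.+1 g)) rot_size_cat rev_cat.
by rewrite /word_dot /= szE Eh !eqxx big_cons.
Qed.

End Pairing.

Section TraceChebyshev.
Context (R : realType) (H : lmodType R) (ip : {dot H for (@idfun R)}).
Context d (T : measurableType d) (N : nat) (X : H -> T -> 'M[R[i]]_N.+1).

Lemma tr_chebV_wick k (f : 'I_k -> H) (n : 'I_k -> nat) :
  (forall i, ip (f i) (f i) = 1) -> (forall i, (1 <= n i)%N) ->
  (forall i, ip (f i) (f (ordS i)) = 0) ->
  tr_chebV X f n = wick_trace ip X (block_word f n (enum 'I_k)).
Proof.
move=> f1 n1 orth; apply/funext => w; rewrite /tr_chebV /wick_trace.
have so : sorted (fun i j => ip (f i) (f j) == 0) (enum 'I_k).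
  by apply: sorted_enum_ord => i; apply/eqP.
rewrite -(@prod_chebV _ _ (fun a b => ip a b) _ (X^~ w) _ _ _ _ f1 n1 so).
by rewrite enumT [index_enum _]unlock.
Qed.

End TraceChebyshev.

Lemma tensor_word_block (R : realType) (H : lmodType R) k (f : 'I_k -> H) (n : 'I_k -> nat) :
  tensor_word f n = map (@cplx_embed R H) (block_word f n (enum 'I_k)).
Proof.
rewrite /tensor_word /block_word map_flatten -map_comp; congr flatten.
by apply: eq_map => i /=; rewrite map_nseq.
Qed.

Theorem mainTheorem6 (R : realType)
    (H : completeNormedModType R) (ip : {dot H for (@idfun R)})
    (ip_norm : forall u : H, `|u| ^+ 2 = ip u u)
    (F : circularTensors ip)
    (d : nat -> measure_display) (T : forall N, measurableType (d N))
    (P : forall N, probability (T N) R)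
    (X : forall N, H -> T N -> 'M[R[i]]_N.+1)
    (hX : forall N, hermitian_gaussian_matrices (P N) ip (X N))
    (k l : nat) (hk : (2 <= k)%N) (hl : (2 <= l)%N)
    (f : 'I_k -> H) (g : 'I_l -> H)
    (f_unit : forall i, `|f i| = 1) (g_unit : forall i, `|g i| = 1)
    (f_orth : forall i, ip (f i) (f (ordS i)) = 0)
    (g_orth : forall i, ip (g i) (g (ordS i)) = 0)
    (n : 'I_k -> nat) (m : 'I_l -> nat)
    (n_ge1 : forall i, (1 <= n i)%N) (m_ge1 : forall i, (1 <= m i)%N) :
  (fun N => k2 (P N) (tr_chebV (X N) f n) (tr_chebV (X N) g m) : R[i]^o) @ \oo -->
  (cyc_dot F
     (circ F (tensor_word f n))
     (circ F (tensor_word (g \o @rev_ord l) (m \o @rev_ord l))) : R[i]^o).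
Proof.
have f1 i : ip (f i) (f i) = 1 by rewrite -ip_norm f_unit expr1n.
have g1 i : ip (g i) (g i) = 1 by rewrite -ip_norm g_unit expr1n.
rewrite cyc_dotE !tensor_word_block rev_block_word cyc_pairing_embed size_rev.
have ipC u v : ip u v = ip v u by rewrite hermC /= expr0 mul1r.
case: k hk f f_unit f_orth n n_ge1 f1 => // k _ f f_unit f_orth n n_ge1 f1.
case: l hl g g_unit g_orth m m_ge1 g1 => // l _ g g_unit g_orth m m_ge1 g1.
have ordS_max q : ordS (@ord_max q) = ord0 by apply: val_inj; rewrite /= modnn.
have lastf := last_block_word 0 f n_ge1.
have lastg := last_block_word 0 g m_ge1; have headg := head_block_word 0 g m_ge1.
have [h Eh] := block_word_cons f n_ge1.
have [g' Eg] := block_word_cons g m_ge1.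
have orth_h : ip (f ord0) (last (f ord0) h) = 0.
  by rewrite Eh /= in lastf; rewrite lastf ipC -ordS_max.
have orth_g : ip (last 0 (block_word g m (enum 'I_l.+1))) (head 0 (block_word g m (enum 'I_l.+1))) = 0.
  by rewrite lastg headg -ordS_max.
have g0 : (0 < size (block_word g m (enum 'I_l.+1)))%N by rewrite Eg.
have lim2 := tends_trace_moment2 hX orth_h g0 orth_g.
have lim1 := tends_trace_moment1 hX orth_h.
have limg : tends (trace_moment ip P X [:: block_word g m (enum 'I_l.+1)]) 0.
  move: orth_g; rewrite Eg /= ipC => orth_g; exact: (tends_trace_moment1 hX orth_g).
rewrite Eh [size (_ :: _)]/= sum_word_dot_rot.
(* the product of the means also tends to 0 *)
have lim := tendsD lim2 (tendsM (tendsM (@tends_cst R (-1)) lim1) limg).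
rewrite mulr0 addr0 in lim; apply: (tends_eq _ lim) => N.
rewrite /k2 !(@tr_chebV_wick _ _ ip) // -Eh !trace_momentE1 mulN1r mulNr.
by rewrite /trace_moment !wick_traces_cons /wick_traces big_nil mulr1.
Qed.
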